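(* Let $\mathbb K$ be an algebraically closed field and let $A=\mathbb K\langle x,y\rangle$ be the free noncommutative associative algebra generated (in degree one) by $x,y$, with homogeneous components $A(k)$. Let $d\ge 50$ be an integer and let $(D(k))_{k\in\mathbb N}$ be a sequence of linear subspaces $D(k)\subseteq A(k)$ such that (1) $D(k)=0$ whenever $k\ge 2$ and $k/\log k<18d$; (2) $D(k)=0$ whenever $2^n-2^{n-3}<k\le 2^n+2^{n-1}$ for some $n\in\mathbb N$; (3) $D(k)=0$ whenever there exist $j,n\in\mathbb N$ such that $D(j)\ne 0$ and $j<2^n<k<\max\{j^{1000},12dnj\}$; (4) $\dim D(k)\le k^d$ for all $k\in\mathbb N$; (5) $D(k)=0$ for all but finitely many $k$. Then there is a surjective $\mathbb K$-algebra homomorphism from $A/\langle D(k)\colon k\in\mathbb N\rangle$ onto an infinite dimensional algebra with at most quadratic growth.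
   Context: $\mathbb N=\{0,1,2,\dots\}$ and $\log$ is the logarithm in base $2$. $A(k)$ is the $\mathbb K$-span of the words of length $k$ in $x,y$. $\langle D(k)\colon k\in\mathbb N\rangle$ is the two-sided ideal of $A$ generated by all the $D(k)$. For an algebra $R$ generated by a finite dimensional subspace $S$, its growth function is $v(n)=\dim(1+S+S^2+\cdots+S^n)$. Write $v\precsim v'$ if $v(n)\le v'(Cn)$ for some constant $C$ and all $n\ge 1$. $R$ has at most quadratic growth if $v(n)\precsim n^2$ (this does not depend on the choice of $S$). *)

(* Defs.v *)
From HB Require Import structures.
From mathcomp Require Import all_boot all_order all_algebra generic_quotient.
From mathcomp.multinomials Require Import monalg.
From mathcomp Require Import boolp classical_sets functions cardinality.
From mathcomp Require Import reals exp.

Set Implicit Arguments.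
Unset Strict Implicit.
Unset Printing Implicit Defensive.

Import Order.TTheory GRing.Theory Num.Theory.

Local Open Scope classical_set_scope.
Local Open Scope ring_scope.
Local Open Scope quotient_scope.

Section LinearSets.
Variables (K : fieldType) (V : lmodType K).
Implicit Types (X U : set V) (m : nat).

Definition is_subspace U : Prop := GRing.submod_closed [in U].

Definition lspan X : set V := smallest is_subspace X.

Definition lin_indep m (b : 'I_m -> V) : Prop :=
  forall c : 'I_m -> K, \sum_i c i *: b i = 0 -> forall i, c i = 0.

Definition has_dim U m : Prop :=
  exists b : 'I_m -> V, lin_indep b /\ U = lspan (range b).

Definition finite_dim U : Prop := exists m, has_dim U m.

(* Junk value 0 if U is not a finite dimensional subspace; it is only applied
   to finite dimensional ones below. *)
Definition lin_dim U : nat := xget 0%N [set m | has_dim U m].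

End LinearSets.

Section Growth.
Variables (K : fieldType) (R : algType K).
Implicit Types (S U W : set R).

Definition prodsp U W : set R := lspan [set u * w | u in U & w in W].

Definition powsp S (n : nat) : set R := iter n (prodsp S) (lspan [set 1]).

Definition growth S (n : nat) : nat :=
  lin_dim (lspan (\bigcup_(i < n.+1) powsp S i)).

(* Generation as a unital algebra, in accordance with the summand 1 in the
   growth function. *)
Definition generates S : Prop :=
  smallest (fun T : set R => GRing.subalg_closed [in T]) S = setT.

End Growth.

Definition growth_le (v w : nat -> nat) : Prop :=
  exists C : nat, forall n, (1 <= n)%N -> (v n <= w (C * n))%N.

Definition at_most_quadratic_growth (K : fieldType) (R : algType K) : Prop :=
  exists S : set R, [/\ is_subspace S, finite_dim S, generates S &
    growth_le (growth S) (fun n => n ^ 2)%N].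

Definition infinite_dimensional (K : fieldType) (V : lmodType K) : Prop :=
  ~ finite_dim [set: V].

(* The quotient of an algebra by the two-sided ideal generated by a set. The
   quotient may be the zero ring, so it is only given the structures of a
   (possibly trivial) ring and of a K-vector space: the library's [algType]
   requires 1 != 0. *)
Section Quotient.
Variables (K : fieldType) (R : algType K).

Definition two_sided_ideal (I : set R) : Prop :=
  [/\ I 0, forall a b, I a -> I b -> I (a - b)
    & forall r a s, I a -> I (r * a * s)].

Definition ideal_gen (X : set R) : set R := smallest two_sided_ideal X.

Variable X : set R.
Local Notation I := (ideal_gen X).

Lemma ideal_genP : two_sided_ideal I.
Proof.
split=> [M [[]] //|a b Ia Ib M HM|r a s Ia M HM].
  by case: (HM) => -[_ MB _] _; apply: MB; [exact: Ia|exact: Ib].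
by case: (HM) => -[_ _ MM] _; apply: MM; exact: Ia.
Qed.

Let I0 : I 0. Proof. by case: ideal_genP. Qed.
Let IB a b : I a -> I b -> I (a - b). Proof. by case: ideal_genP => _ + _; apply. Qed.
Let IM r a s : I a -> I (r * a * s). Proof. by case: ideal_genP => _ _; apply. Qed.
Let IN a : I a -> I (- a). Proof. by move=> Ia; rewrite -sub0r; apply: IB. Qed.
Let ID a b : I a -> I b -> I (a + b).
Proof. by move=> Ia /IN Ib; rewrite -[b]opprK; apply: IB. Qed.
Let IMl r a : I a -> I (r * a).
Proof. by move=> Ia; rewrite -[r * a]mulr1; apply: IM. Qed.
Let IMr a s : I a -> I (a * s).
Proof. by move=> Ia; rewrite -[a]mul1r; apply: IM. Qed.
Let IZ c a : I a -> I (c *: a).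
Proof. by move=> Ia; rewrite -mulr_algl; apply: IMl. Qed.

Definition congr_ideal : rel R := fun a b => `[< I (a - b) >].

Lemma congr_ideal_equiv : equiv_class_of congr_ideal.
Proof.
split=> [a|a b|b a c /asboolP ab /asboolP bc]; first by apply/asboolP; rewrite subrr.
  by apply/asboolP/asboolP=> /IN; rewrite opprB.
by apply/asboolP; rewrite -[a](subrK b) -addrA; apply: ID.
Qed.
Canonical congr_ideal_equivRel := EquivRelPack congr_ideal_equiv.

Definition alg_quot := {eq_quot congr_ideal}.
HB.instance Definition _ := Choice.on alg_quot.
HB.instance Definition _ := EqQuotient.on alg_quot.

Definition quot_proj (a : R) : alg_quot := \pi a.

Lemma quot_projP a b : quot_proj a = quot_proj b <-> ideal_gen X (a - b).
Proof.
by rewrite /quot_proj; split=> [/eqmodP /asboolP|Iab]; last exact/eqmodP/asboolP.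
Qed.

Lemma quot_projK : cancel repr quot_proj.
Proof. exact: reprK. Qed.

Let reprP a : I (repr (quot_proj a) - a).
Proof. by apply/quot_projP; rewrite quot_projK. Qed.

Definition quot_zero : alg_quot := quot_proj 0.
Definition quot_one : alg_quot := quot_proj 1.
Definition quot_opp (u : alg_quot) : alg_quot := quot_proj (- repr u).
Definition quot_add (u v : alg_quot) : alg_quot := quot_proj (repr u + repr v).
Definition quot_mul (u v : alg_quot) : alg_quot := quot_proj (repr u * repr v).
Definition quot_scale (c : K) (u : alg_quot) : alg_quot :=
  quot_proj (c *: repr u).

Let oppE a : quot_opp (quot_proj a) = quot_proj (- a).
Proof. by apply/quot_projP; rewrite -opprD; apply: IN. Qed.

Let addE a b : quot_add (quot_proj a) (quot_proj b) = quot_proj (a + b).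
Proof. by apply/quot_projP; rewrite opprD addrACA; apply: ID. Qed.

Let mulE a b : quot_mul (quot_proj a) (quot_proj b) = quot_proj (a * b).
Proof.
apply/quot_projP; rewrite -[_ * _](subrK (a * repr (quot_proj b))) -addrA.
by rewrite -mulrBl -mulrBr; apply: ID; [apply: IMr|apply: IMl].
Qed.

Let scaleE c a : quot_scale c (quot_proj a) = quot_proj (c *: a).
Proof. by apply/quot_projP; rewrite -scalerBr; apply: IZ. Qed.

Let quotW (P : alg_quot -> Prop) : (forall a, P (quot_proj a)) -> forall u, P u.
Proof. by move=> Pp u; rewrite -[u]quot_projK. Qed.

Fact quot_addA : associative quot_add.
Proof. by elim/quotW=> a; elim/quotW=> b; elim/quotW=> c; rewrite !addE addrA. Qed.
Fact quot_addC : commutative quot_add.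
Proof. by elim/quotW=> a; elim/quotW=> b; rewrite !addE addrC. Qed.
Fact quot_add0 : left_id quot_zero quot_add.
Proof. by elim/quotW=> a; rewrite !addE add0r. Qed.
Fact quot_addN : left_inverse quot_zero quot_opp quot_add.
Proof. by elim/quotW=> a; rewrite oppE addE addNr. Qed.

HB.instance Definition _ :=
  GRing.isZmodule.Build alg_quot quot_addA quot_addC quot_add0 quot_addN.

Fact quot_mulA : associative quot_mul.
Proof. by elim/quotW=> a; elim/quotW=> b; elim/quotW=> c; rewrite !mulE mulrA. Qed.
Fact quot_mul1 : left_id quot_one quot_mul.
Proof. by elim/quotW=> a; rewrite mulE mul1r. Qed.
Fact quot_1mul : right_id quot_one quot_mul.
Proof. by elim/quotW=> a; rewrite mulE mulr1. Qed.
Fact quot_mulDl : left_distributive quot_mul quot_add.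
Proof.
elim/quotW=> a; elim/quotW=> b; elim/quotW=> c.
by rewrite addE !mulE addE mulrDl.
Qed.
Fact quot_mulDr : right_distributive quot_mul quot_add.
Proof.
elim/quotW=> a; elim/quotW=> b; elim/quotW=> c.
by rewrite addE !mulE addE mulrDr.
Qed.

HB.instance Definition _ := GRing.Zmodule_isPzRing.Build alg_quot
  quot_mulA quot_mul1 quot_1mul quot_mulDl quot_mulDr.

Fact quot_scaleA c e u : quot_scale c (quot_scale e u) = quot_scale (c * e) u.
Proof. by elim/quotW: u => a; rewrite !scaleE scalerA. Qed.
Fact quot_scale1 : left_id 1 quot_scale.
Proof. by elim/quotW=> a; rewrite scaleE scale1r. Qed.
Fact quot_scaleDr : right_distributive quot_scale +%R.
Proof.
move=> c; elim/quotW=> a; elim/quotW=> b.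
by rewrite [LHS](congr1 _ (addE a b)) !scaleE [RHS]addE scalerDr.
Qed.
Fact quot_scaleDl u : {morph quot_scale^~ u : c e / c + e}.
Proof.
by elim/quotW: u => a c e; rewrite !scaleE [RHS]addE scalerDl.
Qed.

HB.instance Definition _ := GRing.Zmodule_isLmodule.Build K alg_quot
  quot_scaleA quot_scale1 quot_scaleDr quot_scaleDl.

(* The operations of the quotient are those induced by the projection. *)
Fact quot_proj_zmod_morphism : zmod_morphism quot_proj.
Proof. by move=> a b; rewrite [RHS](congr1 _ (oppE b)) [RHS]addE. Qed.
HB.instance Definition _ :=
  GRing.isZmodMorphism.Build R alg_quot quot_proj quot_proj_zmod_morphism.

Fact quot_proj_monoid_morphism : monoid_morphism quot_proj.
Proof. by split=> // a b; rewrite [RHS]mulE. Qed.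
HB.instance Definition _ :=
  GRing.isMonoidMorphism.Build R alg_quot quot_proj quot_proj_monoid_morphism.

Fact quot_proj_scalable : scalable quot_proj.
Proof. by move=> c a; rewrite [RHS]scaleE. Qed.
HB.instance Definition _ :=
  GRing.isScalable.Build K R alg_quot *:%R quot_proj quot_proj_scalable.

End Quotient.

(* K<x,y> as the monoid algebra of the free monoid on the two letters
   [false] (for x) and [true] (for y). *)
Definition free_alg (K : fieldType) := {malg K[{fmonom bool}]}.
HB.instance Definition _ (K : fieldType) := GRing.Lalgebra.on (free_alg K).

Fact free_alg_scaleAr (K : fieldType) (c : K) (f g : free_alg K) :
  c *: (f * g) = f * (c *: g).
Proof.
apply/malgP=> k; rewrite mcoeffZ mcoeffMl.
rewrite (mcoeffMlw _ (finmap.fsubset_refl (msupp f)) (msuppZ_le c g)) mulr_sumr.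
apply: eq_bigr => k1 _; rewrite mulr_sumr; apply: eq_bigr => k2 _.
by rewrite mcoeffZ mulrnAr mulrCA.
Qed.
HB.instance Definition _ (K : fieldType) :=
  GRing.Lalgebra_isAlgebra.Build K (free_alg K) (@free_alg_scaleAr K).

Section FreeAlgebra.
Variable K : fieldType.

Definition letter (b : bool) : free_alg K := mkmalgU (fmu b) 1.

Definition word (w : seq bool) : free_alg K := \prod_(b <- w) letter b.

Definition homog (k : nat) : set (free_alg K) :=
  lspan [set word w | w in [set w : seq bool | size w = k]].

End FreeAlgebra.

Definition log2 (R : realType) (t : R) : R := ln t / ln 2.

(* Main.v *)
Require Import Defs.
From HB Require Import structures.
From mathcomp Require Import all_boot all_order all_algebra.
From mathcomp.multinomials Require Import monalg.
From mathcomp Require Import boolp classical_sets functions cardinality.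
From mathcomp Require Import reals exp.
From mathcomp Require Import zify ring lra.

Import Order.TTheory GRing.Theory Num.Theory.

Local Open Scope classical_set_scope.
Local Open Scope ring_scope.

Set Implicit Arguments.
Unset Strict Implicit.
Unset Printing Implicit Defensive.

(** It suffices to find a length m and a nonzero linear functional phi on A(m)
    such that the product Phi of copies of phi over consecutive blocks of length
    m vanishes on u r v for all relations r and words u, v. Then the graded
    ideal of all a such that Phi vanishes on u a v for all u, v contains the
    relations; its quotient is infinite dimensional, as Phi is nonzero on words
    of every length divisible by m, and has bounded homogeneous components,
    since only words u, v shorter than m matter. So the growth is even linear.

    The functional is built by running through the dyadic ranges of degrees,
    keeping two independent functionals on A(m), m = 2^e, all of whose block
    products kill the relations of degree at most 2^n. If there are relations of
    degree in ]2^n, 2^(n+1)], then their degrees lie in [6tm, 7tm] where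
    t = 2^(n-2-e). Regarding the two functionals as letters, take products
    a g b g of length 8t, where a and b are functionals on words of length t and
    g is the indicator of 0^(3t). A relation, wherever it is placed, contains one
    of the factors a, b completely and meets at most one other factor. This
    yields fewer than 2^t - 1 linear conditions on a, and then, a being fixed,
    on b, and b may be chosen in two independent ways. *)

(** * Words and products of functionals over blocks *)

Section Words.

Fixpoint words (n : nat) : seq (seq bool) :=
  if n is n'.+1 then map (cons false) (words n') ++ map (cons true) (words n')
  else [:: [::]].

Fixpoint short_words (n : nat) : seq (seq bool) :=
  if n is n'.+1 then short_words n' ++ words n' else [::].

Lemma mem_words n w : (w \in words n) = (size w == n).
Proof.
elim: n w => [|n IHn] [|b w] //=.
  by rewrite mem_cat; apply/negbTE/norP; split; apply/mapP=> -[].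
have inj c : injective (cons c : seq bool -> seq bool) by move=> ? ? [].
have notin c : c != b -> (b :: w \in map (cons c) (words n)) = false.
  by move=> cb; apply/mapP=> -[v _ [bc _]]; rewrite bc eqxx in cb.
by rewrite eqSS -IHn mem_cat; case: b notin => notin;
  [rewrite (notin false)|rewrite (notin true)] => //; rewrite ?orbF (mem_map (inj _)).
Qed.

Lemma size_words n : size (words n) = (2 ^ n)%N.
Proof. by elim: n => //= n IHn; rewrite size_cat !size_map IHn addnn -mul2n expnS. Qed.

Lemma uniq_words n : uniq (words n).
Proof.
elim: n => //= n IHn; rewrite cat_uniq !map_inj_uniq => [|? ? [] //|? ? [] //].
rewrite IHn andbT /=; apply/hasPn=> _ /mapP[w _ ->].
by apply/mapP=> -[].
Qed.

Lemma mem_short_words n w : (w \in short_words n) = (size w < n)%N.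
Proof.
by elim: n => //= n IHn; rewrite mem_cat IHn mem_words [RHS]ltnS [RHS]leq_eqVlt orbC.
Qed.

Lemma size_short_words n : (size (short_words n) < 2 ^ n)%N.
Proof.
elim: n => //= n IHn; rewrite size_cat size_words expnS mul2n -addnn.
by rewrite ltn_add2r.
Qed.

Variable K : fieldType.
Implicit Types (F G : seq bool -> K).

Lemma eq_words n F G : (forall w, size w = n -> F w = G w) ->
  \sum_(w <- words n) F w = \sum_(w <- words n) G w.
Proof. by move=> FG; apply: eq_big_seq => w; rewrite mem_words => /eqP /FG. Qed.

Lemma sum_words_cat m n F : \sum_(w <- words (m + n)) F w =
  \sum_(u <- words m) \sum_(v <- words n) F (u ++ v).
Proof.
elim: m F => [|m IHm] F /=; first by rewrite big_seq1.
by rewrite !big_cat /= !big_map /= !IHm.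
Qed.

Lemma sum_words_delta n F x : size x = n ->
  \sum_(w <- words n) F w * (w == x)%:R = F x.
Proof.
move=> sx; rewrite (bigD1_seq x) ?uniq_words ?mem_words ?sx //= eqxx mulr1.
by rewrite big1 ?addr0 // => w /negbTE->; rewrite mulr0.
Qed.

Definition all_false (w : seq bool) : K := (~~ has id w)%:R.

Lemma all_false_cat u v : all_false (u ++ v) = all_false u * all_false v.
Proof. by rewrite /all_false has_cat negb_or -natrM mulnb. Qed.

Lemma sum_all_false n F :
  \sum_(w <- words n) all_false w * F w = F (nseq n false).
Proof.
rewrite -(@sum_words_delta n F) ?size_nseq //; apply: eq_words => w sw.
rewrite mulrC /all_false -sw; congr (_ * _%:R); congr nat_of_bool.
by elim: w {sw} => //= -[].
Qed.

Section BlockProducts.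
Variables (T : Type) (m : nat).
Implicit Types (phi : T -> seq bool -> K) (L : seq T).

(** Letters after the last block are ignored and a short word gives truncated blocks, so the product
    is meant for words of length [m * size L]. *)
Fixpoint block_prod phi L (w : seq bool) : K :=
  if L is x :: L' then phi x (take m w) * block_prod phi L' (drop m w) else 1.

Lemma block_prodE phi x L w :
  block_prod phi (x :: L) w = phi x (take m w) * block_prod phi L (drop m w).
Proof. by []. Qed.

Lemma block_prod_cons phi x L u v : size u = m ->
  block_prod phi (x :: L) (u ++ v) = phi x u * block_prod phi L v.
Proof. by move=> su /=; rewrite take_size_cat // drop_size_cat. Qed.

Lemma block_prod_cat phi L1 L2 w : block_prod phi (L1 ++ L2) w =
  block_prod phi L1 (take (m * size L1) w) *
  block_prod phi L2 (drop (m * size L1) w).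
Proof.
elim: L1 w => [|x L1 IH] w /=; first by rewrite muln0 drop0 mul1r.
by rewrite IH mulrA mulnS take_takel ?leq_addr // drop_drop take_drop [(_ + m)%N]addnC.
Qed.

Lemma block_prod_catE phi L1 L2 u v : size u = (m * size L1)%N ->
  block_prod phi (L1 ++ L2) (u ++ v) = block_prod phi L1 u * block_prod phi L2 v.
Proof. by move=> su; rewrite block_prod_cat take_size_cat // drop_size_cat. Qed.

Lemma sum_block_prod_cons phi phi' x y L L' n :
  \sum_(w <- words (m + n)) block_prod phi (x :: L) w * block_prod phi' (y :: L') w =
  (\sum_(w <- words m) phi x w * phi' y w) *
  (\sum_(w <- words n) block_prod phi L w * block_prod phi' L' w).
Proof.
rewrite sum_words_cat mulr_suml; apply: eq_words => u su.
rewrite mulr_sumr; apply: eq_bigr => v _.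
by rewrite !block_prod_cons // mulrACA.
Qed.

End BlockProducts.

(** A biorthogonal system certifies the independence of [phi] by an explicit witness, which carries
    over to block products and substitutions. *)
Definition dual (T : eqType) m (e phi : T -> seq bool -> K) : Prop :=
  forall i j, \sum_(w <- words m) e i w * phi j w = (i == j)%:R.

Lemma dual_block_prod (T : eqType) m (e phi : T -> seq bool -> K) L L' :
  dual m e phi -> size L = size L' ->
  \sum_(w <- words (m * size L)) block_prod m e L w * block_prod m phi L' w =
  (L == L')%:R.
Proof.
move=> de; elim: L L' => [|x L IH] [|y L'] //=.
  by rewrite muln0 big_seq1 mulr1.
by case=> sL; rewrite mulnS sum_block_prod_cons IH // de -natrM mulnb eqseq_cons.
Qed.

(** The functionals on words of length [t] form a space of dimension [2 ^ t], and so few conditions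
    leave solutions of dimension at least two. *)
Lemma independent_solutions t (I : eqType) (idx : seq I) (l : I -> seq bool -> K) :
  (size idx + 1 < 2 ^ t)%N ->
  exists e b : bool -> seq bool -> K, dual t e b /\
    forall i j, i \in idx -> \sum_(w <- words t) l i w * b j w = 0.
Proof.
rewrite -size_words => ht; set W := words t in ht *.
pose C := \matrix_(q < size idx, p < size W) l (tnth (in_tuple idx) q) (nth [::] W p).
pose N := kermx C^T.
have rN : (1 < \rank N)%N.
  by rewrite mxrank_ker; have := rank_leq_col C^T; move: ht; lia.
(* The columns of a right inverse of the kernel basis are the dual functionals. *)
have [B NB] := row_freeP (row_base_free N).
have rN' (j : bool) : (j < \rank N)%N by case: j => //; apply: ltnW.
pose f j := Ordinal (rN' j).
pose fn (x : 'I_(size W) -> K) w := odflt 0 (omap x (insub (index w W))).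
have fnE x (p : 'I_(size W)) : fn x (nth [::] W p) = x p.
  by rewrite /fn index_uniq ?uniq_words // valK.
have sumE (F : seq bool -> K) :
    \sum_(w <- W) F w = \sum_(p < size W) F (nth [::] W p).
  by rewrite (big_nth [::]) big_mkord.
exists (fun i => fn (fun p => B p (f i))), (fun j => fn (fun p => row_base N (f j) p)).
split=> [i j|i j /(nthP i)[q qs <-]]; rewrite sumE.
  have := congr1 (fun M : 'M_(\rank N) => M (f j) (f i)) NB.
  rewrite !mxE -val_eqE /= => eqji.
  rewrite (_ : (i == j) = (j == i :> nat)) -?eqji; last by case: (i) (j) => [] [].
  by apply: eq_bigr => p _; rewrite !fnE mulrC.
have NC : row_base N *m C^T = 0.
  by apply/eqP; rewrite -sub_kermx eq_row_base.
have := congr1 (fun M => fun_of_matrix M (f j) (Ordinal qs)) NC; rewrite !mxE => eq0.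
rewrite -[RHS]eq0; apply: eq_bigr => p _.
by rewrite !fnE !mxE mulrC (tnth_nth i).
Qed.

End Words.

(** * Functionals killing given relations *)

Section AlternatingSolutions.
Variable K : fieldType.

Definition glue (s : bool) (u x : seq bool) := if s then x ++ u else u ++ x.

Lemma size_glue s u x : size (glue s u x) = (size u + size x)%N.
Proof. by case: s; rewrite size_cat // addnC. Qed.

(** Values at glued words become a linear form in the values at all words of length [t], as
    [independent_solutions] requires. *)
Lemma sum_words_glue s u c t (F G : seq bool -> K) : (size u + c = t)%N ->
  \sum_(z <- words t) (\sum_(x <- words c) G x * (z == glue s u x)%:R) * F z =
  \sum_(x <- words c) G x * F (glue s u x).
Proof.
move=> ut; under eq_bigr do rewrite mulr_suml.
rewrite exchange_big; apply: eq_words => x sx /=.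
rewrite -(@sum_words_delta _ t F) ?size_glue ?sx // mulr_sumr.
by apply: eq_bigr => z _; rewrite mulrAC mulrA.
Qed.

(* A form l i is evaluated on one factor in full and on the other, cut by the
   end of a window, with c i letters inside. If c i <= h, it is made to vanish
   for each of the 2 ^ (c i) inner words, separately on a and on b; otherwise
   for each of the 2 ^ (2 * h - c i) outer words. Choosing b after a, all
   conditions are linear and there are few enough of them. *)
Lemma alternating_solutions h (I : eqType) (idx : seq I) (c : I -> nat)
    (side : I -> bool) (l : I -> seq bool -> seq bool -> K) :
  (2 * (size idx * 2 ^ h) + 1 < 2 ^ (2 * h))%N ->
  exists (e b : bool -> seq bool -> K) (e0 a : seq bool -> K),
  [/\ dual (2 * h) e b, \sum_(w <- words (2 * h)) e0 w * a w = 1 &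
   forall i u j, i \in idx -> (size u + c i = 2 * h)%N ->
     \sum_(x <- words (c i)) \sum_(y <- words (2 * h))
        l i x y * a (glue (side i) u x) * b j y = 0 /\
     \sum_(x <- words (c i)) \sum_(y <- words (2 * h))
        l i x y * b j (glue (side i) u x) * a y = 0].
Proof.
set t := (2 * h)%N => ht.
(* Conditions are indexed by words of length [h] only; shorter words are recovered as prefixes after
   padding. *)
pose idx1 := [seq (i, z) | i <- idx, z <- words h].
have sidx1 : size idx1 = (size idx * 2 ^ h)%N by rewrite size_allpairs size_words.
have idx1P i z n : i \in idx -> (size z <= h)%N -> n = size z ->
    exists2 z', take n z' = z & (i, z') \in idx1.
  move=> ii sz ->; exists (z ++ nseq (h - size z) false); first by rewrite take_size_cat.
  by apply: allpairs_f => //; rewrite mem_words size_cat size_nseq subnKC.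
have [|e1 [a' [da a0]]] := @independent_solutions K t _ idx1
  (fun p => l p.1 (take (c p.1) p.2)); first by rewrite sidx1; lia.
pose a := a' false.
(* Conditions on [b] once [a] is fixed. In the last two forms the outer word [u] is prescribed: [b]
   is read in full and [a] is cut if [s] holds, and conversely otherwise. *)
pose lb (q : (I * seq bool) * bool) : seq bool -> K :=
  let: ((i, z), s) := q in
  if (c i <= h)%N then l i (take (c i) z) else
  let u := take (t - c i) z in
  if s then fun y => \sum_(x <- words (c i)) l i x y * a (glue (side i) u x)
  else fun y => \sum_(x <- words (c i))
    (\sum_(w <- words t) l i x w * a w) * (y == glue (side i) u x)%:R.
have [|e [b [db b0]]] := @independent_solutions K t _
  [seq (p, s) | p <- idx1, s <- [:: true; false]] lb.
  by rewrite size_allpairs sidx1 /=; lia.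
exists e, b, (e1 false), a; split => // [|i u j ii ut]; first by rewrite da.
have sumC (F G : seq bool -> K) :
    \sum_(x <- words (c i)) \sum_(y <- words t) l i x y * F x * G y =
    \sum_(x <- words (c i)) F x * \sum_(y <- words t) l i x y * G y.
  apply: eq_bigr => x _; rewrite mulr_sumr.
  by apply: eq_bigr => y _; rewrite mulrAC mulrC.
rewrite !sumC; have [ch|ch] := leqP (c i) h.
  split; rewrite big_seq big1 // => x; rewrite mem_words => /eqP sx.
    have [|z zx zi] := idx1P i x (c i) ii _ (esym sx); first by rewrite sx.
    have := b0 ((i, z), true) j; rewrite /lb ch zx => ->; rewrite ?mulr0 //.
    by apply: allpairs_f => //; rewrite !inE.
  have [|z zx zi] := idx1P i x (c i) ii _ (esym sx); first by rewrite sx.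
  by have := a0 (i, z) false zi; rewrite /= zx => ->; rewrite mulr0.
have [uE uh] : (t - c i)%N = size u /\ (size u <= h)%N by move: ut; rewrite /t; lia.
have [z zu zi] := idx1P i u _ ii uh uE.
have mb s : ((i, z), s) \in [seq (p, s) | p <- idx1, s <- [:: true; false]].
  by apply: allpairs_f => //; case: s; rewrite !inE.
split.
  have := b0 ((i, z), true) j (mb _); rewrite /lb leqNgt ch zu => eq0.
  rewrite -[RHS]eq0; under [RHS]eq_bigr do rewrite mulr_suml.
  rewrite exchange_big; apply: eq_bigr => x _ /=; rewrite mulr_sumr.
  by apply: eq_bigr => y _; rewrite mulrA [_ * l i x y]mulrC.
have := b0 ((i, z), false) j (mb _); rewrite /lb leqNgt ch zu /= sum_words_glue //.
by move=> eq0; rewrite -[RHS]eq0; apply: eq_bigr => x _; rewrite mulrC.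
Qed.

End AlternatingSolutions.

(** * Relations placed in an alternating product with gaps *)

Section Windows.
Variables (K : fieldType) (t : nat).
Local Arguments block_prod : simpl never.

Definition slot (theta : option bool -> seq bool -> K) x (z : seq bool) : K :=
  theta x (take t z) * all_false K (drop t z).

Lemma slot_cat theta x u v : size u = t ->
  slot theta x (u ++ v) = theta x u * all_false K v.
Proof. by move=> su; rewrite /slot take_size_cat // drop_size_cat. Qed.

Lemma sum_slot theta theta' x y :
  \sum_(w <- words (4 * t)) slot theta x w * slot theta' y w =
  \sum_(w <- words t) theta x w * theta' y w.
Proof.
rewrite (_ : 4 * t = t + 3 * t)%N; last by lia.
rewrite sum_words_cat; apply: eq_words => u su.
under eq_words => v sv do rewrite !slot_cat // mulrACA mulrC -mulrA.
by rewrite sum_all_false /all_false has_nseq andbF mul1r.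
Qed.

(** [None] labels the factor a and [Some c] one of the two choices of b, so chains of compatible
    labels alternate between a and b. *)
Definition compat (x y : option bool) := isSome x != isSome y.

Variable theta : option bool -> seq bool -> K.

Lemma sum_gap n (F G : seq bool -> K) :
  (forall w, size w = n -> F w = all_false K w * G w) ->
  \sum_(w <- words n) F w = G (nseq n false).
Proof. by move=> FG; rewrite -sum_all_false; apply: eq_words. Qed.

Variables (s : nat) (r : seq bool -> K).

(* Blocks have length 4 * t and functionals theta on their first t letters, the
   remaining letters being read as false. A window of length s beginning p
   letters into a block contains the whole theta-part of the next block, and
   cut_size p letters of at most one other theta-part: that of its first block
   if p < t, of its third one otherwise. Truncated subtraction makes cut_size
   vanish when the window stops before the third block. *)
Definition cut_size p := if (p < t)%N then (t - p)%N else minn t (p + s - 8 * t).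

Definition cut_form p (x y : seq bool) : K :=
  let O n := nseq n false in
  if (p < t)%N then r (x ++ O (3 * t)%N ++ y ++ O (s + p - 5 * t)%N)
  else r (O (4 * t - p)%N ++ y ++ O (minn (3 * t) (p + s - 5 * t)) ++ x ++
          O (p + s - 9 * t)%N).

Hypothesis t_gt0 : (0 < t)%N.
Hypothesis s_ge : (6 * t <= s)%N.
Hypothesis s_le : (s <= 7 * t + 1)%N.
Hypothesis cut0 : forall p u x y, (p < 4 * t)%N -> (size u + cut_size p = t)%N ->
  compat x y ->
  \sum_(w <- words (cut_size p)) \sum_(z <- words t)
    cut_form p w z * theta x (glue (t <= p)%N u w) * theta y z = 0.

(** The sum splits along the theta-parts and gaps met by the window. Gap letters are forced to be
    [false], what lies outside the window is a constant factor [P], and the rest is an instance of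
    [cut0]. *)
Lemma window_vanish L u v : sorted compat L ->
  (size u + s + size v = 4 * t * size L)%N ->
  \sum_(w <- words s) r w * block_prod (4 * t) (slot theta) L (u ++ w ++ v) = 0.
Proof.
elim: L u => [|x L IH] u.
  by rewrite /=; lia.
(* A first block lying before the window factors out. *)
have [ut|ut] := leqP (4 * t) (size u).
  move=> sL szu; rewrite -(cat_take_drop (4 * t) u).
  set u1 := take _ u; set u2 := drop _ u.
  have su1 : size u1 = (4 * t)%N by rewrite size_takel.
  transitivity (slot theta x u1 *
    \sum_(w <- words s) r w * block_prod (4 * t) (slot theta) L (u2 ++ w ++ v)).
    rewrite mulr_sumr; apply: eq_bigr => w _.
    by rewrite -catA block_prod_cons // mulrCA.
  rewrite IH ?mulr0 ?(path_sorted sL) //.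
  by move: szu; rewrite /u2 size_drop /=; lia.
case: L IH => [|y L] _ /=; first by lia.
move=> /andP[xy sL] szu; have yx : compat y x by rewrite /compat eq_sym.
set p := size u in ut szu; have cutp := cut0 ut.
(* If [p < t], then [s <= 7 * t + 1] forces the window to end within the second block. *)
move: cutp; rewrite /cut_size /cut_form; case: (ltnP p t) => pt /= cutp.
  set q := (s + p - 5 * t)%N in cutp.
  set v1 := take (8 * t - p - s) v; set v2 := drop (8 * t - p - s) v.
  have sv1 : size v1 = (8 * t - p - s)%N by rewrite size_takel //; lia.
  set P := all_false K v1 * block_prod (4 * t) (slot theta) L v2.
  pose O n := nseq n false.
  transitivity (P * \sum_(w <- words (t - p)) \sum_(z <- words t)
    r (w ++ O (3 * t)%N ++ z ++ O q) * theta x (u ++ w) * theta y z); last first.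
    by rewrite (cutp u x y) ?mulr0 // -/p; lia.
  rewrite (_ : s = (t - p) + (3 * t + (t + q)))%N; last by rewrite /q; lia.
  rewrite sum_words_cat mulr_sumr; apply: eq_words => w0 s0.
  rewrite sum_words_cat (sum_gap (G := fun w1 => P * \sum_(z <- words t)
    r (w0 ++ w1 ++ z ++ O q) * theta x (u ++ w0) * theta y z)) // => w1 s1.
  rewrite sum_words_cat !mulr_sumr; apply: eq_words => w2 s2.
  rewrite (sum_gap (G := fun w3 => all_false K w1 *
     (P * (r (w0 ++ w1 ++ w2 ++ w3) * theta x (u ++ w0) * theta y w2)))) // => w3 s3.
  rewrite -(cat_take_drop (8 * t - p - s) v) -/v1 -/v2.
  rewrite (_ : u ++ _ = ((u ++ w0) ++ w1) ++ (w2 ++ (w3 ++ v1)) ++ v2); last first.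
    by rewrite !catA.
  have su0 : size (u ++ w0) = t by rewrite size_cat s0 -/p; lia.
  rewrite block_prod_cons; last by rewrite size_cat su0 s1; lia.
  rewrite block_prod_cons; last by rewrite !size_cat s2 s3 sv1 /q; lia.
  by rewrite !slot_cat // all_false_cat /P; ring.
set u0 := take t u; set u1 := drop t u.
have su0 : size u0 = t by rewrite size_takel.
have su1 : size u1 = (p - t)%N by rewrite size_drop.
pose O n := nseq n false.
have uE : u = u0 ++ u1 by rewrite cat_take_drop.
(* The window starts in the first gap. It ends either in the second gap, where no factor is cut, or
   in the third block. *)
have [e8|e8] := leqP (p + s) (8 * t).
  have c0 : minn t (p + s - 8 * t) = 0%N by lia.
  have q0 : (p + s - 9 * t = 0)%N by lia.
  have g0 : minn (3 * t) (p + s - 5 * t) = (p + s - 5 * t)%N by lia.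
  move: cutp; rewrite c0 q0 g0 => cutp.
  set q := (p + s - 5 * t)%N in cutp.
  set v1 := take (8 * t - p - s) v; set v2 := drop (8 * t - p - s) v.
  have sv1 : size v1 = (8 * t - p - s)%N by rewrite size_takel //; lia.
  set P := all_false K u1 * all_false K v1 * block_prod (4 * t) (slot theta) L v2.
  transitivity (P * \sum_(z <- words t)
    r (O (4 * t - p)%N ++ z ++ O q) * theta x u0 * theta y z); last first.
    have := cutp u0 x y; rewrite addn0 big_seq1 => cut1.
    rewrite [X in P * X](_ : _ = 0) ?mulr0 // -[RHS](cut1 su0 xy).
    by apply: eq_bigr => z _; rewrite /= cats0.
  rewrite [X in words X](_ : s = (4 * t - p) + (t + q))%N; last by rewrite /q; lia.
  rewrite sum_words_cat (sum_gap (G := fun w1 => P * \sum_(z <- words t)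
    r (w1 ++ z ++ O q) * theta x u0 * theta y z)) // => w1 s1.
  rewrite sum_words_cat !mulr_sumr; apply: eq_words => w2 s2.
  rewrite (sum_gap (G := fun w3 => all_false K w1 *
     (P * (r (w1 ++ w2 ++ w3) * theta x u0 * theta y w2)))) // => w3 s3.
  rewrite -(cat_take_drop (8 * t - p - s) v) -/v1 -/v2 [in u ++ _]uE.
  rewrite (_ : _ ++ _ ++ v1 ++ v2 = (u0 ++ (u1 ++ w1)) ++ (w2 ++ (w3 ++ v1)) ++ v2);
    last by rewrite !catA.
  rewrite block_prod_cons; last by rewrite !size_cat su0 su1 s1; lia.
  rewrite block_prod_cons; last by rewrite !size_cat s2 s3 sv1 /q; lia.
  by rewrite !slot_cat // !all_false_cat /P; ring.
case: L sL szu => [|z L]; first by rewrite /=; lia.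
move=> /andP[yz _] szu; have zy : compat z y by rewrite /compat eq_sym.
have g0 : minn (3 * t) (p + s - 5 * t) = (3 * t)%N by lia.
(* The window takes [c] letters of the third theta-part and then [q] of the third gap. *)
move: cutp; rewrite g0; set c := minn _ _; set q := (p + s - 9 * t)%N => cutp.
have cqE : (c + q = p + s - 8 * t)%N by rewrite /c /q; lia.
have c_le : (c <= t)%N by exact: geq_minl.
set v0 := take (t - c) v; set v12 := drop (t - c) v.
set v1 := take (3 * t - q) v12; set v2 := drop (3 * t - q) v12.
have [szv q3] : ((t - c) + (3 * t - q) <= size v)%N /\ (q <= 3 * t)%N.
  by move: szu; rewrite /c /q /=; lia.
have sv0 : size v0 = (t - c)%N by rewrite size_takel //; lia.
have sv1 : size v1 = (3 * t - q)%N by rewrite size_takel // size_drop; lia.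
set P := theta x u0 * all_false K u1 * all_false K v1 *
  block_prod (4 * t) (slot theta) L v2.
transitivity (P * \sum_(w <- words c) \sum_(y' <- words t)
    r (O (4 * t - p)%N ++ y' ++ O (3 * t)%N ++ w ++ O q) * theta z (w ++ v0)
    * theta y y'); last first.
  by rewrite (cutp v0 z y) ?mulr0 // sv0; lia.
rewrite [X in words X](_ : s = (4 * t - p) + (t + (3 * t + (c + q))))%N; last by lia.
rewrite sum_words_cat (sum_gap (G := fun w1 => P * \sum_(w <- words c)
   \sum_(y' <- words t) r (w1 ++ y' ++ O (3 * t)%N ++ w ++ O q)
   * theta z (w ++ v0) * theta y y')) // => w1 s1.
rewrite exchange_big sum_words_cat !mulr_sumr; apply: eq_words => w2 s2 /=.
rewrite sum_words_cat (sum_gap (G := fun w3 => all_false K w1 * (P *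
   \sum_(w <- words c) r (w1 ++ w2 ++ w3 ++ w ++ O q)
   * theta z (w ++ v0) * theta y w2))) // => w3 s3.
rewrite sum_words_cat !mulr_sumr; apply: eq_words => w4 s4.
rewrite (sum_gap (G := fun w5 => all_false K w3 * (all_false K w1 * (P *
   (r (w1 ++ w2 ++ w3 ++ w4 ++ w5) * theta z (w4 ++ v0) * theta y w2))))) // => w5 s5.
rewrite -(cat_take_drop (t - c) v) -/v0 -/v12.
rewrite -(cat_take_drop (3 * t - q) v12) -/v1 -/v2 [in u ++ _]uE.
rewrite (_ : _ ++ _ ++ v0 ++ v1 ++ v2 = (u0 ++ (u1 ++ w1)) ++ (w2 ++ w3) ++
  ((w4 ++ v0) ++ (w5 ++ v1)) ++ v2).
  rewrite block_prod_cons; last by rewrite !size_cat su0 su1 s1; lia.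
  rewrite block_prod_cons; last by rewrite !size_cat s2 s3; lia.
  rewrite block_prod_cons; last by rewrite !size_cat s4 s5 sv0 sv1; lia.
  by rewrite !slot_cat ?size_cat ?s4 ?sv0 ?subnKC // !all_false_cat /P; ring.
(* Either the cut block is complete and v0 is empty, or the window ends in it and w5 is. *)
have wv : w5 ++ v0 = v0 ++ w5.
  have [/size0nil->|/size0nil->] : size v0 = 0%N \/ size w5 = 0%N; rewrite ?cats0 //.
  by rewrite sv0 s5 /q; move: cqE; rewrite /q; lia.
by rewrite -!catA [w5 ++ v0 ++ _]catA wv -!catA.
Qed.

End Windows.

(** * Relations killed by block products *)

Section Killing.
Variable K : fieldType.
Local Arguments block_prod : simpl never.
Implicit Types (phi psi e eps : bool -> seq bool -> K) (r : seq bool -> K).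

(** Quantifying over all label sequences makes the property stable under regrouping blocks into
    longer ones with new functionals. *)
Definition kills m phi k r : Prop := forall L u v,
  (size u + k + size v = m * size L)%N ->
  \sum_(w <- words k) r w * block_prod m phi L (u ++ w ++ v) = 0.

Lemma block_prod_flatten (T T' : Type) m q (phi : T -> seq bool -> K)
    (f : T' -> seq T) (L : seq T') w : (forall x, size (f x) = q) ->
  block_prod (m * q) (fun x => block_prod m phi (f x)) L w =
  block_prod m phi (flatten (map f L)) w.
Proof.
move=> fq; elim: L w => //= x L IH w.
by rewrite block_prod_cat fq -IH.
Qed.

(** Each relation is paired with each starting position in a block, and [alternating_solutions]
    kills the resulting cut forms. Two blocks, labelled [None] and [Some c], make one new block, so
    any sequence of new labels alternates. *)
Lemma kill_letter_relations h (I : eqType) (idx : seq I) (s : I -> nat)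
    (r : I -> seq bool -> K) : let t := (2 * h)%N in
  (0 < h)%N -> (2 * (size idx * (4 * t) * 2 ^ h) + 1 < 2 ^ t)%N ->
  (forall i, i \in idx -> (6 * t <= s i <= 7 * t + 1)%N) ->
  exists eps psi, dual (4 * t * 2) eps psi /\
    forall i, i \in idx -> kills (4 * t * 2) psi (s i) (r i).
Proof.
move=> t h0 ht hs.
have [|eps [b [e0 [a [db da ab]]]]] := @alternating_solutions K h _
  [seq (i, p) | i <- idx, p <- iota 0 (4 * t)]
  (fun j => cut_size t (s j.1) j.2) (fun j => (t <= j.2)%N)
  (fun j => cut_form t (s j.1) (r j.1) j.2).
  by rewrite size_allpairs size_iota.
pose theta f (g : bool -> seq bool -> K) x := if x is Some j then g j else f : seq bool -> K.
pose psi' f g (c : bool) := block_prod (4 * t) (slot t (theta f g)) [:: None; Some c].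
exists (psi' e0 eps), (psi' a b); split=> [i j|i ii L u v szu].
  rewrite (_ : 4 * t * 2 = 4 * t + (4 * t + 0))%N; last by lia.
  by rewrite !sum_block_prod_cons !sum_slot da (db i j) big_seq1 !mul1r mulr1.
under eq_bigr do rewrite block_prod_flatten //.
have /andP[s_ge s_le] := hs i ii.
apply: (window_vanish _ s_ge s_le); first by rewrite /t; lia.
- move=> p u' x y p4 szu' xy.
  have ip : (i, p) \in [seq (i, p) | i <- idx, p <- iota 0 (4 * t)].
    by apply: allpairs_f; rewrite ?mem_iota.
  have abp c := ab (i, p) u' c ip szu'.
  by case: x y xy => [c|] [c'|] // _; case: (abp true) (abp false) => ? ? [? ?];
    [case: c|case: c'].
- case: L szu => //= c L _; elim: L c => //= c L IH c'; exact: IH.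
rewrite szu -mulnA; congr (_ * _)%N.
by elim: (L) => //= c L' IH; rewrite mulnS IH.
Qed.

Section Substitution.
Variables (M m : nat) (psi phi : bool -> seq bool -> K).

Definition subst_block psi phi (c : bool) (z : seq bool) : K :=
  \sum_(L <- words M) psi c L * block_prod m phi L z.

Lemma block_prod_subst L z : block_prod (M * m) (subst_block psi phi) L z =
  \sum_(J <- words (M * size L)) block_prod M psi L J * block_prod m phi J z.
Proof.
elim: L z => [|c L IH] z /=; first by rewrite muln0 big_seq1 mulr1.
rewrite mulnS sum_words_cat block_prodE IH mulr_suml.
apply: eq_words => J1 sJ1; rewrite mulr_sumr; apply: eq_words => J2 sJ2.
by rewrite block_prod_cons // block_prod_cat sJ1 mulrACA [(M * m)%N]mulnC.
Qed.

(** A product of new blocks is a linear combination of products of old ones. *)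
Lemma kills_subst k r : kills m phi k r ->
  kills (M * m) (subst_block psi phi) k r.
Proof.
move=> kr L u v szu; under eq_bigr do rewrite block_prod_subst mulr_sumr.
rewrite exchange_big big_seq big1 //= => J; rewrite mem_words => /eqP sJ.
under eq_bigr do rewrite mulrCA; rewrite -mulr_sumr kr ?mulr0 // sJ szu.
by rewrite mulnA [(m * M)%N]mulnC.
Qed.

(* Reading words over blocks of length m as words in the letters phi false and
   phi true turns the placements of r in s blocks into relations of degree s. *)
Lemma kills_recoded k r : (0 < m)%N ->
  (forall u v s, (size u < m)%N -> (size v < m)%N ->
     (size u + k + size v = m * s)%N ->
     kills M psi s (fun J =>
       \sum_(w <- words k) r w * block_prod m phi J (u ++ w ++ v))) ->
  kills (M * m) (subst_block psi phi) k r.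
Proof.
move=> m0 kr L u v szu.
(* The complete blocks in [u] and [v] factor out, leaving margins [u2] and [v2] shorter than [m]. *)
set i := (size u %/ m)%N; set j := (size v %/ m)%N.
have [iu jv] : (m * i <= size u)%N /\ (m * j <= size v)%N.
  by rewrite ![(m * _)%N]mulnC !leq_trunc_div.
pose u1 := take (m * i) u; pose u2 := drop (m * i) u.
pose v2 := take (size v - m * j) v; pose v1 := drop (size v - m * j) v.
have su1 : size u1 = (m * i)%N by rewrite size_takel.
have sv1 : size v1 = (m * j)%N by rewrite size_drop subKn.
have su2 : (size u2 < m)%N.
  have := divn_eq (size u) m; have := ltn_pmod (size u) m0.
  by rewrite size_drop -/i; lia.
have sv2 : (size v2 < m)%N.
  have := divn_eq (size v) m; have := ltn_pmod (size v) m0.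
  by rewrite size_takel ?leq_subr // -/j; lia.
have uE : u = u1 ++ u2 by rewrite cat_take_drop.
have vE : v = v2 ++ v1 by rewrite cat_take_drop.
have ijL : (i + j <= M * size L)%N.
  by rewrite -(leq_pmul2l m0) mulnA [(m * M)%N]mulnC -szu mulnDr; lia.
have [s sE] : {s | M * size L = i + (s + j)}%N.
  by exists (M * size L - i - j)%N; lia.
have kills_s : (size u2 + k + size v2 = m * s)%N.
  move: szu; rewrite [(M * m)%N]mulnC -mulnA sE uE vE !size_cat su1 sv1 !mulnDr; lia.
under eq_bigr do rewrite block_prod_subst mulr_sumr.
rewrite exchange_big sE sum_words_cat big_seq big1 // => J1.
rewrite mem_words => /eqP sJ1; rewrite sum_words_cat exchange_big big_seq big1 //= => J3.
rewrite mem_words => /eqP sJ3.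
transitivity (block_prod m phi J1 u1 * block_prod m phi J3 v1 *
  \sum_(J <- words s) (\sum_(w <- words k) r w * block_prod m phi J (u2 ++ w ++ v2))
    * block_prod M psi L (J1 ++ J ++ J3)); last first.
  by rewrite kr ?mulr0 // sJ1 sJ3 sE addnA.
rewrite mulr_sumr; apply: eq_words => J sJ; rewrite mulr_suml mulr_sumr.
apply: eq_words => w sw; rewrite uE vE -catA.
rewrite (_ : u2 ++ w ++ v2 ++ v1 = (u2 ++ w ++ v2) ++ v1); last by rewrite -!catA.
rewrite block_prod_catE ?su1 ?sJ1 //.
rewrite block_prod_catE; last by rewrite sJ -kills_s !size_cat sw; lia.
by ring.
Qed.

End Substitution.

(** Block products of [e] and [phi] are dual, which reduces the pairing to that of [eps] and
    [psi]. *)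
Lemma dual_subst M m eps psi e phi : dual M eps psi -> dual m e phi ->
  dual (M * m) (subst_block M m eps e) (subst_block M m psi phi).
Proof.
move=> dpsi dphi c d.
transitivity (\sum_(J <- words M) eps c J * psi d J); last exact: dpsi.
under eq_bigr do rewrite mulr_suml.
rewrite exchange_big; apply: eq_words => J sJ /=.
rewrite -(@sum_words_delta _ M (fun J' => eps c J * psi d J') J) //.
under eq_bigr do rewrite mulr_sumr.
rewrite exchange_big; apply: eq_words => J' sJ' /=.
rewrite [_ == _]eq_sym -(dual_block_prod dphi) ?sJ ?sJ' // mulr_sumr.
rewrite mulnC; apply: eq_bigr => w _.
by rewrite mulrACA.
Qed.

(** A relation with margins shorter than [m] is recoded as a relation between letters; the factor
    [2 ^ m * 2 ^ m] bounds the number of pairs of margins. Substituting [phi] into the solution for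
    letters keeps killed what [phi] kills. *)
Lemma kill_relations m e phi h (I : eqType) (idx : seq I) (k : I -> nat)
    (r : I -> seq bool -> K) : let t := (2 * h)%N in
  dual m e phi -> (0 < m)%N -> (0 < h)%N ->
  (2 * (size idx * (2 ^ m * 2 ^ m) * (4 * t) * 2 ^ h) + 1 < 2 ^ t)%N ->
  (forall i, i \in idx -> (6 * t * m <= k i <= 7 * t * m)%N) ->
  exists e' phi', [/\ dual (8 * t * m) e' phi',
    forall i, i \in idx -> kills (8 * t * m) phi' (k i) (r i) &
    forall k r, kills m phi k r -> kills (8 * t * m) phi' k r].
Proof.
move=> t dphi m0 h0 ht hk.
pose idx' := [seq (i, p) | i <- idx,
  p <- [seq (u, v) | u <- short_words m, v <- short_words m]].
pose deg (q : I * (seq bool * seq bool)) := (size q.2.1 + k q.1 + size q.2.2)%N.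
pose idx2 := [seq q <- idx' | (m %| deg q)%N].
have [|||eps [psi [dpsi kpsi]]] := @kill_letter_relations h _ idx2
  (fun q => deg q %/ m)%N
  (fun q J => \sum_(w <- words (k q.1)) r q.1 w * block_prod m phi J (q.2.1 ++ w ++ q.2.2)).
- exact: h0.
- apply: leq_ltn_trans ht; rewrite leq_add2r leq_mul2l /= !leq_mul2r.
  apply/orP; right; apply/orP; right.
  rewrite size_filter (leq_trans (count_size _ _)) // !size_allpairs.
  by rewrite leq_mul2l leq_mul ?orbT // ltnW // size_short_words.
- move=> q; rewrite mem_filter => /andP[/dvdnP[s sE]].
  move=> /allpairsP[[i p] /= [ii /allpairsP[[u v] /= [uu vv pE]] qE]].
  have /andP[k1 k2] := hk i ii; rewrite sE mulnK //; move: sE uu vv.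
  rewrite qE pE /deg !mem_short_words /= => sE uu vv.
  (* The margins add less than [2 * m] letters, whence at most [7 * t + 1] blocks. *)
  apply/andP; split; first by rewrite -(leq_pmul2r m0) -sE; lia.
  by rewrite -ltnS -(ltn_pmul2r m0) -sE; lia.
rewrite (_ : 8 * t = 4 * t * 2)%N; last by lia.
exists (subst_block (4 * t * 2) m eps e), (subst_block (4 * t * 2) m psi phi).
split; first exact: dual_subst; last by move=> *; exact: kills_subst.
move=> i ii; apply: kills_recoded => // u v s su sv sE.
have := kpsi (i, (u, v)); rewrite /deg /= sE mulKn //; apply.
rewrite mem_filter /deg /= sE dvdn_mulr //=.
by do 2![apply: allpairs_f => //]; rewrite mem_short_words.
Qed.

End Killing.

(** * Linear forms and the free algebra *)

Section LinearForms.
Variables (K : fieldType) (V : lmodType K).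
Implicit Types (U X : set V).

Definition is_lin (f : V -> K) : Prop :=
  forall c x y, f (c *: x + y) = c * f x + f y.

Lemma is_linE f : is_lin f ->
  [/\ f 0 = 0, forall x y, f (x + y) = f x + f y,
      forall c x, f (c *: x) = c * f x &
      forall n (c : 'I_n -> K) (b : 'I_n -> V),
        f (\sum_i c i *: b i) = \sum_i c i * f (b i)].
Proof.
move=> lf; have f0 : f 0 = 0.
  by have /eqP := lf 1 0 0; rewrite scaler0 addr0 mul1r -subr_eq subrr eq_sym => /eqP.
have fD x y : f (x + y) = f x + f y by rewrite -[x]scale1r lf mul1r scale1r.
have fZ c x : f (c *: x) = c * f x by rewrite -[c *: x]addr0 lf f0 addr0.
split=> // n c b; rewrite (big_morph f fD f0).
by apply: eq_bigr.
Qed.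

Lemma is_subspaceE U : is_subspace U <->
  U 0 /\ forall c x y, U x -> U y -> U (c *: x + y).
Proof.
split=> -[U0 UD]; split; first by rewrite -in_setE.
- by move=> c x y Ux Uy; rewrite -in_setE; apply: UD; rewrite in_setE.
- by rewrite in_setE.
by move=> c x y; rewrite !in_setE; apply: UD.
Qed.

Lemma subspace_sum U n (c : 'I_n -> K) (b : 'I_n -> V) :
  is_subspace U -> (forall i, U (b i)) -> U (\sum_i c i *: b i).
Proof.
move=> /is_subspaceE[U0 UD] Ub; elim/big_rec: _ => // i x _ Ux.
exact: UD.
Qed.

Lemma lspan_subspace X : is_subspace (lspan X).
Proof.
apply/is_subspaceE; split=> [M [/is_subspaceE[]]//|c x y Xx Xy M MX].
case: (MX) => /is_subspaceE[_ MD] _; apply: MD; first exact: Xx.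
exact: Xy.
Qed.

Lemma lspan_sub U X : is_subspace U -> X `<=` U -> lspan X `<=` U.
Proof. exact: smallest_sub. Qed.

Lemma sub_lspan X : X `<=` lspan X.
Proof. exact: sub_gen_smallest. Qed.

Lemma lspan_range n (b : 'I_n -> V) :
  lspan (range b) = [set x | exists c, x = \sum_i c i *: b i].
Proof.
apply/seteqP; split=> [|_ [c ->]]; last first.
  apply: subspace_sum; first exact: lspan_subspace.
  by move=> i; apply: sub_lspan; exists i.
apply: lspan_sub => [|_ [i _ <-]].
  apply/is_subspaceE; split=> [|a _ _ [c ->] [c' ->]].
    by exists (fun=> 0); rewrite big1 // => i _; rewrite scale0r.
  exists (fun i => a * c i + c' i); rewrite scaler_sumr -big_split.
  by apply: eq_bigr => i _; rewrite scalerDl scalerA.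
exists (fun j => (j == i)%:R); rewrite (bigD1 i) //= eqxx scale1r big1 ?addr0 // => j.
by move=> /negbTE->; rewrite scale0r.
Qed.

Section Separated.
Variables (N : nat) (g : 'I_N -> V -> K) (U : set V).
Hypothesis lin_g : forall i, is_lin (g i).
Hypothesis U_sub : is_subspace U.
Hypothesis sep_g : forall x, U x -> (forall i, g i x = 0) -> x = 0.

(** Among more than [N] vectors some nontrivial combination is annihilated by all [N] forms, hence
    is zero. *)
Lemma lin_indep_le m (b : 'I_m -> V) :
  (forall i, U (b i)) -> lin_indep b -> (m <= N)%N.
Proof.
move=> Ub ib; rewrite leqNgt; apply/negP => Nm.
pose B := \matrix_(i, j) g j (b i).
have /rowV0Pn[v /sub_kermxP vB v0] : kermx B != 0.
  by rewrite -mxrank_eq0 mxrank_ker; have := rank_leq_col B; lia.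
case/eqP: v0; apply/rowP => i; rewrite mxE; apply: ib i.
apply: sep_g => [|j]; first exact: subspace_sum.
have [_ _ _ ->] := is_linE (lin_g j).
transitivity ((v *m B) 0 j); last by rewrite vB mxE.
by rewrite mxE; apply: eq_bigr => i _; rewrite mxE.
Qed.

(** An independent family of maximal size spans, since a vector outside its span could be added to
    it. *)
Lemma has_dim_separated : exists m, has_dim U m.
Proof.
pose P m := `[< exists2 b : 'I_m -> V, forall i, U (b i) & lin_indep b >].
have P0 : exists m, P m.
  by exists 0%N; apply/asboolP; exists (fun=> 0) => [[]|? ? []].
have PN m : P m -> (m <= N)%N by move=> /asboolP[b Ub ib]; apply: lin_indep_le ib.
case: (ex_maxnP P0 PN) => m /asboolP[b Ub ib] maxm; exists m, b; split=> //.
apply/seteqP; split=> [x Ux|]; last by apply: lspan_sub => // _ [i _ <-].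
apply: contrapT => nx; suff /maxm : P m.+1 by rewrite ltnn.
pose b' (i : 'I_m.+1) := if unlift ord_max i is Some j then b j else x.
have b'l j : b' (lift ord_max j) = b j by rewrite /b' liftK.
apply/asboolP; exists b' => [i|c].
  by rewrite /b'; case: unliftP => [j|] _.
rewrite (bigD1_ord ord_max) //= {1}/b' unlift_none => c0.
have cm : c ord_max = 0.
  apply/eqP/negPn/negP => cm; apply: nx; rewrite lspan_range.
  exists (fun j => - (c ord_max)^-1 * c (lift ord_max j)).
  under eq_bigr do rewrite -scalerA -b'l.
  rewrite -scaler_sumr; move/eqP: c0; rewrite addrC addr_eq0 => /eqP->.
  by rewrite scaleNr scalerN opprK scalerA mulVf // scale1r.
move=> i; case: (unliftP ord_max i) => [j|] -> //.
move: c0; rewrite cm scale0r add0r => c0; apply: (ib (fun j => c (lift ord_max j))).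
by rewrite -[RHS]c0; apply: eq_bigr => j' _; rewrite b'l.
Qed.

Lemma lin_dim_le W : W `<=` U -> (lin_dim W <= N)%N.
Proof.
(* The default value 0 satisfies the bound when [W] has no dimension. *)
move=> WU; rewrite /lin_dim; case: xgetP => // q _ [b [ib WE]].
apply: lin_indep_le ib => i; apply: WU; rewrite WE.
by apply: sub_lspan; exists i.
Qed.

End Separated.

End LinearForms.

Section Coefficients.
Variable K : fieldType.
Implicit Types (a : free_alg K) (F : seq bool -> K).

Definition coef a (w : seq bool) : K := a@_(FMonom w).

Lemma wordE w : word K w = << FMonom w >>.
Proof.
rewrite /word; elim: w => [|b w IH]; first by rewrite big_nil -fmoneE.
rewrite big_cons IH /letter malgM_def fgmulUU mulr1; congr << _ >>.
by rewrite [LHS]fmmulE fmuE.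
Qed.

Lemma coef_lin w : is_lin (coef^~ w).
Proof. by move=> c x y; rewrite /coef mcoeffD mcoeffZ. Qed.

Lemma coef_word w w' : coef (word K w) w' = (w' == w)%:R.
Proof. by rewrite /coef wordE mcoeffU1 eq_sym -val_eqE. Qed.

Lemma free_alg_expand a : a = \sum_(m <- finmap.enum_fset (msupp a)) a@_m *: word K (fmonom_val m).
Proof.
rewrite {1}[a]monalgE; apply: eq_bigr => m _; rewrite wordE fmK.
by rewrite -mul_malgC malgM_def fgmulUU mulr1 mul1m.
Qed.

Lemma free_alg_ind (P : free_alg K -> Prop) : P 0 ->
  (forall c w a, P a -> P (c *: word K w + a)) -> forall a, P a.
Proof.
move=> P0 PD a; rewrite (free_alg_expand a).
by elim/big_rec: _ => // m x _ Px; apply: PD.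
Qed.

Lemma homog_expand k a : homog k a ->
  a = \sum_(w <- words k) coef a w *: word K w.
Proof.
move: a; apply: lspan_sub => [|_ [w /= wk <-]].
  apply/is_subspaceE; split=> [|c x y xE yE].
    by rewrite big1 // => w _; rewrite /coef mcoeff0 scale0r.
  rewrite {1}xE {1}yE scaler_sumr -big_split; apply: eq_bigr => w _ /=.
  by rewrite coef_lin scalerDl scalerA.
rewrite (bigD1_seq w) ?uniq_words ?mem_words ?wk //=.
rewrite coef_word eqxx scale1r big1 ?addr0 // => w' /negbTE ww'.
by rewrite coef_word ww' scale0r.
Qed.

Definition pairing F a : K := mmap idfun (fun m : {fmonom bool} => F m) a.

Lemma pairing_lin F : is_lin (pairing F).
Proof.
move=> c x y; rewrite /pairing mmapD; congr (_ + _).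
rewrite (mmapEw (msuppZ_le _ _)) mmapE mulr_sumr.
by apply: eq_bigr => m _; rewrite mcoeffZ mulrA.
Qed.

Lemma pairing_word F w : pairing F (word K w) = F w.
Proof. by rewrite /pairing wordE mmapU mul1r. Qed.

Lemma eq_pairing F G a : (forall w, F w = G w) -> pairing F a = pairing G a.
Proof. by move=> FG; apply: eq_bigr => m _; rewrite FG. Qed.

Lemma pairing_homog F k a : homog k a ->
  pairing F a = \sum_(w <- words k) coef a w * F w.
Proof.
move=> /homog_expand {1}->; have [F0 FD FZ _] := is_linE (pairing_lin F).
rewrite (big_morph _ FD F0); apply: eq_bigr => w _.
by rewrite FZ pairing_word.
Qed.

(** The finitely many coefficients separate points, so [lin_dim U] is a true dimension here and not
    the default value. *)
Lemma subspace_homog_basis U k : is_subspace U -> U `<=` homog k ->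
  exists b : 'I_(lin_dim U) -> free_alg K, U = lspan (range b).
Proof.
move=> Us Uk.
have [||m Um] := @has_dim_separated _ _ _
    (fun i x => coef x (tnth (in_tuple (words k)) i)) U _ Us.
- by move=> i; apply: coef_lin.
- move=> x Ux x0; rewrite (homog_expand (Uk x Ux)) big_tnth big1 // => i _.
  by rewrite x0 scale0r.
have [b [_ bE]] : has_dim U (lin_dim U) by apply: xgetPex; exists m.
by exists b.
Qed.

End Coefficients.

(** * Induction over the dyadic ranges of degrees *)

Section Arithmetic.

Lemma log_bound (R : realType) k d n : (2 <= k)%N -> (2 ^ n <= k)%N ->
  ~ ((k%:R / log2 k%:R : R) < (18 * d)%:R) -> (18 * d * n <= k)%N.
Proof.
move=> k2 nk /negP; rewrite -leNgt => dk.
have l2 : 0 < ln (2 : R) by rewrite ln_gt0 // ltr1n.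
have k0 : (0 : R) < k%:R by rewrite ltr0n; lia.
have nlog : n%:R <= log2 (k%:R : R).
  rewrite /log2 ler_pdivlMr // mulr_natl -lnXn // -natrX ler_ln ?ler_nat //.
  by rewrite posrE ltr0n expn_gt0.
have log0 : 0 < log2 (k%:R : R) by rewrite divr_gt0 // ln_gt0 // ltr1n.
rewrite -(ler_nat R) natrM (le_trans (ler_wpM2l (ler0n _ _) nlog)) //.
by move: dk; rewrite ler_pdivlMr.
Qed.

(** The bound needed by [killing_step] for blocks of length 1; [14 * 2 ^ (n - 3)] is the largest
    degree [7 * 2 ^ (n - 2)] allowed in the range. *)
Lemma first_step_bound d n : (50 <= d)%N -> (9 <= n)%N ->
  (18 * d * n <= 14 * 2 ^ (n - 3))%N ->
  ((d + 2) * n + d + 2 * 2 ^ 0 + 2 <= 2 ^ (n - 3 - 0))%N.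
Proof.
rewrite subn0 expn0 => hd hn; set P := (2 ^ _)%N => hP; nia.
Qed.

Lemma double_le_exp q : (2 * q <= 2 ^ q)%N.
Proof.
by case: q => // q; rewrite expnS leq_mul2l /= ltn_expl.
Qed.

(** The bound needed by [killing_step] when the blocks stem from a relation of degree [j]. Both [d]
    and the block length are at most [2 ^ e], while [n] exceeds [e] by a large factor. *)
Lemma later_step_bound d n e j : (50 <= d)%N -> (18 * d * e.-1 <= j)%N ->
  (2 ^ e.-1 < j < 2 ^ e)%N -> (e.-1 * 1000 <= n)%N ->
  [/\ (e + 3 <= n)%N & ((d + 2) * n + d + 2 * 2 ^ e + 2 <= 2 ^ (n - 3 - e))%N].
Proof.
move=> hd dj /andP[j1 j2] en.
have e1 : (2 <= e)%N by case: e j1 j2 {dj en} => [|[|e]] //=; rewrite ?expn0 ?expn1; lia.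
have e10 : (10 <= e)%N.
  rewrite leqNgt; apply/negP => e9.
  have : (2 ^ e <= 2 ^ 9)%N by rewrite leq_exp2l.
  rewrite [(2 ^ 9)%N]/=; nia.
have de : (d <= 2 ^ e)%N by nia.
split; first by lia.
(* The right-hand side becomes [2 ^ e * 16 * 2 ^ q] with [2 ^ q >= n], which dominates every term on
   the left. *)
have nE : (n = 3 + e + (e + 4 + (n - 7 - 2 * e)))%N by lia.
set q := (n - 7 - 2 * e)%N in nE.
have nq : (n <= 2 * q)%N by lia.
have := leq_trans nq (double_le_exp q).
rewrite (_ : n - 3 - e = e + (4 + q))%N; last by lia.
rewrite expnD [(2 ^ (4 + q))%N]expnD; move: (2 ^ q)%N (2 ^ e)%N de => Q E de nQ.
have n1 : (1 <= n)%N by lia.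
have E1 : (50 <= E)%N by lia.
nia.
Qed.

End Arithmetic.

Section KillingFunctional.
Variables (R : realType) (K : fieldType) (d : nat) (D : nat -> set (free_alg K)).
Hypothesis hd : (50 <= d)%N.
Hypothesis hDsub : forall k, is_subspace (D k).
Hypothesis hDhom : forall k, D k `<=` homog k.
Hypothesis h1 : forall k : nat, (2 <= k)%N ->
  (k%:R / log2 k%:R : R) < (18 * d)%:R -> D k = [set 0].
Hypothesis h2 : forall k n : nat,
  2 ^ n%:Z - 2 ^ (n%:Z - 3) < (k%:R : R) <= 2 ^ n%:Z + 2 ^ (n%:Z - 1) ->
  D k = [set 0].
Hypothesis h3 : forall k j n : nat, D j <> [set 0] ->
  (j < 2 ^ n)%N -> (2 ^ n < k)%N -> (k < maxn (j ^ 1000) (12 * d * n * j))%N ->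
  D k = [set 0].
Hypothesis h4 : forall k, (lin_dim (D k) <= k ^ d)%N.

Lemma relation_degree_log k n : D k <> [set 0] -> (2 <= k)%N -> (2 ^ n <= k)%N ->
  (18 * d * n <= k)%N.
Proof. by move=> Dk k2 nk; apply: (@log_bound R) => // /(h1 k2). Qed.

Lemma no_relation_near_exp k n :
  (7 * 2 ^ n < 8 * k)%N -> (2 * k <= 3 * 2 ^ n)%N -> D k = [set 0].
Proof.
rewrite -(ltr_nat R) -(ler_nat R) !natrM natrX => nk kn; apply: (@h2 _ n).
rewrite !expfzDr ?pnatr_eq0 // -!exprnP -!exprnN expr1.
have -> : (2 : R) ^- 3 = 8^-1 by congr (_^-1); rewrite -natrX.
by move: nk kn; set P := 2 ^+ n; set x := k%:R => nk kn; apply/andP; split; lra.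
Qed.

(** In degree 0 the dimension is at most [0 ^ d = 0]; degree 1 lies in the gap around [2 ^ 0]. *)
Lemma no_relation_small k : (k <= 1)%N -> D k = [set 0].
Proof.
case: k => [|[|//]] _; last first.
  exact: (@no_relation_near_exp _ 0).
have [b ->] := subspace_homog_basis (hDsub 0) (@hDhom 0%N).
have := h4 0; rewrite exp0n; last by lia.
rewrite leqn0 => /eqP dim0; rewrite lspan_range; apply/seteqP.
split=> [_ [c ->]|_ ->]; last by exists (fun=> 0); rewrite big1 // => i _; rewrite scale0r.
by rewrite /= big1 // => -[i ilt]; exfalso; move: ilt; rewrite dim0.
Qed.

(** The gaps around [2 ^ n] and [2 ^ n.+1] leave this interval; [n] is large because
    [k >= 18 * d >= 900]. *)
Lemma relation_degree_range k n : D k <> [set 0] -> (2 ^ n < k <= 2 ^ n.+1)%N ->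
  (9 <= n)%N /\ (6 * 2 ^ (n - 2) <= k <= 7 * 2 ^ (n - 2))%N.
Proof.
move=> Dk /andP[nk kn]; have k2 : (2 <= k)%N.
  by rewrite ltnNge; apply/negP => /no_relation_small.
have n9 : (9 <= n)%N.
  have kd := @relation_degree_log k 1 Dk k2 k2.
  rewrite leqNgt; apply/negP => n9.
  have : (2 ^ n.+1 <= 2 ^ 9)%N by rewrite leq_exp2l.
  by rewrite [(2 ^ 9)%N]/=; lia.
split=> //; have nE : (n = (n - 3) + 3)%N by lia.
set q := (n - 3)%N in nE.
have Q2 : (2 ^ (n - 2) = 2 * 2 ^ q)%N by rewrite -expnS; congr (2 ^ _)%N; lia.
have Q3 : (2 ^ n = 8 * 2 ^ q)%N by rewrite nE expnD mulnC.
rewrite Q2; move: nk kn; rewrite expnS Q3 => nk kn.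
apply/andP; split; rewrite leqNgt; apply/negP => kq; apply: Dk.
  by apply: (@no_relation_near_exp _ n); rewrite Q3; lia.
by apply: (@no_relation_near_exp _ n.+1); rewrite expnS Q3; lia.
Qed.

Definition kills_relations m phi k : Prop :=
  forall a, D k a -> kills m phi k (coef a).

Lemma kills_relations0 m (phi : bool -> seq bool -> K) k :
  D k = [set 0] -> kills_relations m phi k.
Proof.
move=> D0 a; rewrite D0 => -> L u v _; rewrite big1 // => w _.
by rewrite /coef mcoeff0 mul0r.
Qed.

Lemma kills_lspan m (phi : bool -> seq bool -> K) k q (b : 'I_q -> free_alg K) :
  (forall i, kills m phi k (coef (b i))) ->
  forall a, lspan (range b) a -> kills m phi k (coef a).
Proof.
move=> kb; apply: lspan_sub => [|_ [i _ <-] //].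
apply/is_subspaceE; split=> [|c x y kx ky] L u v szu.
  by rewrite big1 // => w _; rewrite /coef mcoeff0 mul0r.
under eq_bigr do rewrite coef_lin mulrDl -mulrA.
by rewrite big_split /= -mulr_sumr kx // ky // mulr0 addr0.
Qed.

(** With [m = 2 ^ e] and [t = 2 * h], one has [t * m = 2 ^ (n - 2)]: the new relations have degrees
    between [6 * t * m] and [7 * t * m], and the new blocks have length [8 * t * m = 2 ^ n.+1]. *)
Lemma killing_step n e (ee phi : bool -> seq bool -> K) k0 :
  dual (2 ^ e) ee phi -> (forall k, (k <= 2 ^ n)%N -> kills_relations (2 ^ e) phi k) ->
  (2 ^ n < k0 <= 2 ^ n.+1)%N -> D k0 <> [set 0] ->
  (e + 3 <= n)%N -> ((d + 2) * n + d + 2 * 2 ^ e + 2 <= 2 ^ (n - 3 - e))%N ->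
  exists ee' phi' : bool -> seq bool -> K, dual (2 ^ n.+1) ee' phi' /\
    forall k, (k <= 2 ^ n.+1)%N -> kills_relations (2 ^ n.+1) phi' k.
Proof.
move=> dphi kphi k0n Dk0 en bnd.
set h := (2 ^ (n - 3 - e))%N in bnd; set m := (2 ^ e)%N in bnd.
have tE : (2 * h = 2 ^ (n - 2 - e))%N by rewrite -expnS; congr (2 ^ _)%N; lia.
have tmE : (2 * h * m = 2 ^ (n - 2))%N.
  by rewrite tE -expnD; congr (2 ^ _)%N; lia.
have PE : (8 * (2 * h) * m = 2 ^ n.+1)%N.
  by rewrite -mulnA tmE (_ : 8 = 2 ^ 3)%N // -expnD; congr (2 ^ _)%N; lia.
pose B k := sval (cid (subspace_homog_basis (hDsub k) (@hDhom k))).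
have BE k : D k = lspan (range (B k)).
  exact: svalP (cid (subspace_homog_basis (hDsub k) (@hDhom k))).
pose ks := [seq k <- iota (2 ^ n).+1 (2 ^ n) | `[< D k <> [set 0] >]].
have ksP k : k \in ks -> D k <> [set 0] /\ (2 ^ n < k <= 2 ^ n.+1)%N.
  by rewrite mem_filter mem_iota => /andP[/asboolP Dk kn]; rewrite expnS; split=> //; lia.
pose idx := [seq (k, q) | k <- ks, q <- iota 0 (lin_dim (D k))].
pose r (p : nat * nat) : seq bool -> K :=
  if insub p.2 is Some q then coef (B p.1 q) else fun=> 0.
(* There are at most [2 ^ n] degrees, each with at most [k ^ d <= 2 ^ (n.+1 * d)] basis elements. *)
have sidx : (size idx <= 2 ^ n * 2 ^ (n.+1 * d))%N.
  rewrite size_allpairs_dep sumnE big_map.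
  apply: (@leq_trans (\sum_(k <- ks) 2 ^ (n.+1 * d))%N).
    rewrite big_seq [leqRHS]big_seq; apply: leq_sum => k /ksP[_ /andP[_ kn]].
    by rewrite size_iota (leq_trans (h4 k)) // expnM leq_exp2r //; lia.
  rewrite big_const_seq iter_addn_0 count_predT mulnC leq_mul2r; apply/orP; right.
  by rewrite size_filter (leq_trans (count_size _ _)) // size_iota.
have [||||ee' [phi' [dphi' kr kold]]] :=
    @kill_relations K m ee phi h _ idx (fun p => p.1) r dphi.
- by rewrite expn_gt0.
- by rewrite expn_gt0.
- have mE : (2 ^ m * 2 ^ m = 2 ^ (2 * m))%N by rewrite -expnD; congr (2 ^ _)%N; lia.
  have h4t : (4 * (2 * h) = 2 ^ (n - e))%N.
    by rewrite tE (_ : 4 = 2 ^ 2)%N // -expnD; congr (2 ^ _)%N; lia.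
  rewrite mE h4t.
  (* The exponent of the bound on the number of conditions; the factor 2 and the summand 1 raise it
     to at most [E.+2]. *)
  pose E := (n + n.+1 * d + 2 * m + (n - e) + h)%N.
  have sE : (size idx * 2 ^ (2 * m) * 2 ^ (n - e) * 2 ^ h <= 2 ^ E)%N.
    rewrite /E (expnD 2 _ h) (expnD 2 _ (n - e)) (expnD 2 _ (2 * m)) (expnD 2 n).
    by rewrite (leq_mul (leq_mul (leq_mul sidx (leqnn _)) (leqnn _)) (leqnn _)).
  apply: (@leq_ltn_trans (2 ^ E.+1 + 1)%N); first by rewrite expnS leq_add2r leq_mul2l.
  have Eh : (E.+2 <= 2 * h)%N.
    by move: bnd; rewrite /E -/h -/m; lia.
  apply: (@leq_trans (2 ^ E.+2)%N); last by rewrite leq_exp2l.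
  by rewrite [(2 ^ E.+2)%N]expnS mul2n -addnn -addnS leq_add2l -[1%N]/(2 ^ 0)%N ltn_exp2l.
- move=> p /allpairsPdep[k [q [/ksP[Dk kn] _ ->]]] /=.
  by have [_] := relation_degree_range Dk kn; rewrite -(mulnA 6) -(mulnA 7) tmE.
exists ee', phi'; rewrite -PE; split=> // k kn a; rewrite PE in kn.
have [kn'|kn'] := leqP k (2 ^ n); first by move=> /kphi/kold; apply.
have [/kills_relations0 D0|Dk] := pselect (D k = [set 0]); first exact: D0.
rewrite BE => /kills_lspan; apply => q.
have := kr (k, q : nat); rewrite /r /= valK; apply.
apply: allpairs_f_dep; last by rewrite mem_iota /=.
rewrite mem_filter mem_iota; apply/andP; split; first exact/asboolP.
by move: kn; rewrite expnS; lia.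
Qed.

(** Blocks grow only in ranges containing relations. The last clause remembers a degree [j]
    responsible for the present length, from which the sparsity hypotheses bound that length against
    the next relation. *)
Lemma killing_functionals n : exists e (ee phi : bool -> seq bool -> K),
  [/\ dual (2 ^ e) ee phi,
      forall k, (k <= 2 ^ n)%N -> kills_relations (2 ^ e) phi k &
      e = 0%N \/ exists2 j, D j <> [set 0] & (2 ^ e.-1 < j < 2 ^ e)%N /\ (e <= n)%N].
Proof.
elim: n => [|n [e [ee [phi [dphi kphi ej]]]]].
  (* Initially the blocks are single letters and the functionals are their indicators. *)
  pose phi (c : bool) (w : seq bool) : K := (w == [:: c])%:R.
  exists 0%N, phi, phi; split; last by left.
    move=> i j; rewrite /= !big_cons big_nil /phi /= !eqseq_cons.
    by case: i; case: j; rewrite /= ?mulr0 ?mulr1 ?addr0 ?add0r.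
  by move=> k k1; apply/kills_relations0/no_relation_small.
have [[k0 [k0n Dk0]]|noD] := pselect (exists k0, (2 ^ n < k0 <= 2 ^ n.+1)%N /\ D k0 <> [set 0]);
    last first.
  exists e, ee, phi; split=> //.
    move=> k kn; have [kn'|kn'] := leqP k (2 ^ n); first exact: kphi.
    apply: kills_relations0; apply: contrapT => Dk; apply: noD.
    by exists k; rewrite kn' kn.
  case: ej => [->|[j Dj [je en]]]; first by left.
  by right; exists j => //; split=> //; apply: leqW.
have [n9 krange] := relation_degree_range Dk0 k0n.
have k2 : (2 <= k0)%N by have : (0 < 2 ^ n)%N by [rewrite expn_gt0]; lia.
have [en bnd] : (e + 3 <= n)%N /\
    ((d + 2) * n + d + 2 * 2 ^ e + 2 <= 2 ^ (n - 3 - e))%N.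
  have /andP[nk kn] := k0n.
  case: ej => [->|[j Dj [je en]]].
    split; first by lia.
    apply: first_step_bound => //.
    have := relation_degree_log Dk0 k2 (ltnW nk).
    have : (2 ^ (n - 2) = 2 * 2 ^ (n - 3))%N by rewrite -expnS; congr (2 ^ _)%N; lia.
    by lia.
  have /andP[j1 j2] := je.
  have j_ge2 : (2 <= j)%N by rewrite ltnNge; apply/negP => /no_relation_small.
  have jk : (j ^ 1000 <= k0)%N.
    rewrite leqNgt; apply/negP => kj; apply: Dk0; apply: (h3 Dj j2).
      by apply: leq_ltn_trans nk; rewrite leq_exp2l.
    by rewrite leq_max kj.
  apply: (@later_step_bound d n e j hd) => //.
    exact: relation_degree_log (ltnW j1).
  (* Exponents are compared in [2 ^ (e.-1 * 1000) < j ^ 1000 <= k0 <= 2 ^ n.+1]. *)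
  rewrite -ltnS -(@ltn_exp2l 2) // expnM.
  by apply: leq_trans (leq_trans jk kn); rewrite ltn_exp2r.
have [ee' [phi' [dphi' kphi']]] := killing_step dphi kphi k0n Dk0 en bnd.
exists n.+1, ee', phi'; split=> //; right; exists k0 => //; split=> //=.
(* The gap below [2 ^ n.+1] makes the upper inequality for [k0] strict. *)
have /andP[-> _] := k0n; rewrite expnS.
have : (2 ^ n = 4 * 2 ^ (n - 2))%N by rewrite -(expnD 2 2); congr (2 ^ _)%N; lia.
by move: (expn_gt0 2 (n - 2)); lia.
Qed.

End KillingFunctional.

(** * The syntactic quotient *)

Section SyntacticQuotient.
Variables (K : fieldType) (Phi : seq bool -> K).
Implicit Types (u v w : seq bool) (a : free_alg K).

Definition degree_form k u v : free_alg K -> K :=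
  pairing (fun w => (size w == k)%:R * Phi (u ++ w ++ v)).

(* Separating the degrees k makes the ideal graded, hence the quotient infinite
   dimensional. *)
Definition syntactic_ideal : set (free_alg K) :=
  [set a | forall k u v, degree_form k u v a = 0].

Lemma degree_form_lin k u v : is_lin (degree_form k u v).
Proof. exact: pairing_lin. Qed.

Lemma word_cat u v : word K (u ++ v) = word K u * word K v.
Proof. by rewrite /word big_cat. Qed.

Lemma is_lin0 (V : lmodType K) (f : V -> K) : is_lin f -> f 0 = 0.
Proof. by case/is_linE. Qed.

Lemma lin_ext (f g : free_alg K -> K) : is_lin f -> is_lin g ->
  (forall w, f (word K w) = g (word K w)) -> f =1 g.
Proof.
move=> lf lg fg; apply: free_alg_ind => [|c w a IH]; first by rewrite !is_lin0.
by rewrite lf lg fg IH.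
Qed.

Lemma pairing0 (F : seq bool -> K) a : (forall w, F w = 0) -> pairing F a = 0.
Proof.
move=> F0; rewrite (eq_pairing (G := fun=> 0) _ F0).
by apply: big1 => x _; rewrite mulr0.
Qed.

Lemma pairing_mull (F : seq bool -> K) x a :
  pairing F (word K x * a) = pairing (fun w => F (x ++ w)) a.
Proof.
move: a; apply: lin_ext => [c a b||w]; last by rewrite -word_cat !pairing_word.
  by rewrite mulrDr -scalerAr pairing_lin.
exact: pairing_lin.
Qed.

Lemma pairing_mulr (F : seq bool -> K) x a :
  pairing F (a * word K x) = pairing (fun w => F (w ++ x)) a.
Proof.
move: a; apply: lin_ext => [c a b||w]; last by rewrite -word_cat !pairing_word.
  by rewrite mulrDl -scalerAl pairing_lin.
exact: pairing_lin.
Qed.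

Lemma syntactic_ideal_subspace : is_subspace syntactic_ideal.
Proof.
apply/is_subspaceE; split=> [|c x y Ex Ey] k u v.
  by have [] := is_linE (degree_form_lin k u v).
by rewrite degree_form_lin Ex Ey mulr0 addr0.
Qed.

(** Multiplication by a word moves it into the context [u] or [v] and lowers the tested degree by
    its length; in degrees shorter than the word the form vanishes. *)
Lemma syntactic_ideal_two_sided : two_sided_ideal syntactic_ideal.
Proof.
have /is_subspaceE[E0 ED] := syntactic_ideal_subspace.
have EN a b : syntactic_ideal a -> syntactic_ideal b -> syntactic_ideal (a - b).
  by move=> Ea Eb; rewrite addrC -scaleN1r; apply: ED.
split=> //; move=> r a s Ea.
have {Ea} : syntactic_ideal (r * a).
  move: r; apply: free_alg_ind => [|c x r Er]; first by rewrite mul0r.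
  rewrite mulrDl -scalerAl; apply: ED; last exact: Er.
  move=> k u v.
  rewrite /degree_form pairing_mull; have [xk|xk] := leqP (size x) k.
    rewrite -[RHS](Ea (k - size x)%N (u ++ x) v); apply: eq_pairing => w.
    by rewrite size_cat -!catA -[in LHS](subnKC xk) eqn_add2l.
  apply: pairing0 => w; rewrite size_cat.
  by rewrite (_ : _ == k = false) ?mul0r //; apply/eqP; lia.
move=> Era; move: s; apply: free_alg_ind => [|c x s Er]; first by rewrite mulr0.
rewrite mulrDr -scalerAr; apply: ED; last exact: Er.
move=> k u v.
rewrite /degree_form pairing_mulr; have [xk|xk] := leqP (size x) k.
  rewrite -[RHS](Era (k - size x)%N u (x ++ v)); apply: eq_pairing => w.
  by rewrite size_cat -!catA -[in LHS](subnK xk) eqn_add2r.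
apply: pairing0 => w; rewrite size_cat.
by rewrite (_ : _ == k = false) ?mul0r //; apply/eqP; lia.
Qed.

Lemma ideal_gen_syntactic : ideal_gen syntactic_ideal = syntactic_ideal.
Proof. by apply: smallest_id; apply: syntactic_ideal_two_sided. Qed.

Local Notation proj0 := (@quot_proj K (free_alg K) syntactic_ideal).

Lemma quot_proj_syntactic a b : proj0 a = proj0 b <-> syntactic_ideal (a - b).
Proof. by rewrite quot_projP ideal_gen_syntactic. Qed.

(* The proof argument makes the type nontrivial, as required of an [algType]. *)
Definition syntactic_alg of Phi [::] != 0 : Type := alg_quot syntactic_ideal.

Variable Phi_nil : Phi [::] != 0.
Local Notation Q := (syntactic_alg Phi_nil).

HB.instance Definition _ := GRing.PzRing.copy Q (alg_quot syntactic_ideal).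
HB.instance Definition _ := GRing.Lmodule.copy Q (alg_quot syntactic_ideal).

Definition syntactic_proj (a : free_alg K) : Q := proj0 a.
Local Notation proj := syntactic_proj.

HB.instance Definition _ := GRing.RMorphism.copy proj proj0.
HB.instance Definition _ := GRing.Linear.copy proj proj0.

Lemma syntactic_projP a b : proj a = proj b <-> syntactic_ideal (a - b).
Proof. exact: quot_proj_syntactic. Qed.

Definition syntactic_repr (x : Q) : free_alg K := repr (x : alg_quot syntactic_ideal).

Lemma syntactic_reprK : cancel syntactic_repr proj.
Proof. exact: quot_projK. Qed.

Fact syntactic_oner_neq0 : (1 : Q) != 0.
Proof.
apply/eqP => /syntactic_projP/(_ 0%N [::] [::]); rewrite subr0 => /eqP.
have -> : 1 = word K [::] by rewrite /word big_nil.
by rewrite /degree_form pairing_word /= mul1r (negbTE Phi_nil).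
Qed.
HB.instance Definition _ := GRing.PzSemiRing_isNonZero.Build Q syntactic_oner_neq0.

Fact syntactic_scalerAl (c : K) (x y : Q) : c *: (x * y) = (c *: x) * y.
Proof.
rewrite -[x]syntactic_reprK -[y]syntactic_reprK -rmorphM -!linearZ -rmorphM.
by rewrite scalerAl.
Qed.
HB.instance Definition _ :=
  GRing.LSemiModule_isLSemiAlgebra.Build K Q syntactic_scalerAl.

Fact syntactic_scalerAr (c : K) (x y : Q) : c *: (x * y) = x * (c *: y).
Proof.
rewrite -[x]syntactic_reprK -[y]syntactic_reprK -rmorphM -!linearZ -rmorphM.
by rewrite scalerAr.
Qed.
HB.instance Definition _ :=
  GRing.LSemiAlgebra_isSemiAlgebra.Build K Q syntactic_scalerAr.

End SyntacticQuotient.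

Section SyntacticAlgebra.
Variables (K : fieldType) (Phi : seq bool -> K) (Phi_nil : Phi [::] != 0).
Local Notation B := (syntactic_alg Phi_nil).
Local Notation proj := (syntactic_proj Phi_nil).

Lemma syntactic_ind (P : B -> Prop) : (forall a, P (proj a)) -> forall x, P x.
Proof. by move=> Pp x; rewrite -[x]syntactic_reprK. Qed.

Definition quot_form k u v (x : B) : K := degree_form Phi k u v (syntactic_repr x).

Lemma quot_form_proj k u v a : quot_form k u v (proj a) = degree_form Phi k u v a.
Proof.
have /syntactic_projP/(_ k u v) := syntactic_reprK (proj a).
rewrite addrC -scaleN1r (degree_form_lin Phi) mulN1r => /eqP.
by rewrite addrC subr_eq0 => /eqP.
Qed.

Lemma quot_form_lin k u v : is_lin (quot_form k u v).
Proof.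
move=> c; elim/syntactic_ind=> a; elim/syntactic_ind=> b.
by rewrite -linearP !quot_form_proj (degree_form_lin Phi).
Qed.

Lemma quot_form_inj (x : B) : (forall k u v, quot_form k u v x = 0) -> x = 0.
Proof.
elim/syntactic_ind: x => a a0; rewrite -[RHS](raddf0 proj).
by apply/syntactic_projP => k u v; rewrite subr0 -quot_form_proj.
Qed.

Definition hom_comp i : set B := [set proj a | a in homog i].

(** Elements of degree at most [n], described by the vanishing of forms of higher degree instead of
    by representatives. *)
Definition bounded_part n : set B :=
  [set x | forall k u v, (n < k)%N -> quot_form k u v x = 0].

Lemma bounded_part_subspace n : is_subspace (bounded_part n).
Proof.
apply/is_subspaceE; split=> [k u v _|c x y xn yn k u v nk].
  by rewrite (is_lin0 (quot_form_lin k u v)).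
by rewrite quot_form_lin xn // yn // mulr0 addr0.
Qed.

Lemma hom_comp_bounded i n : (i <= n)%N -> hom_comp i `<=` bounded_part n.
Proof.
move=> i_n _ [a ai <-] k u v nk; rewrite quot_form_proj /degree_form.
rewrite (pairing_homog _ ai) big_seq big1 // => w; rewrite mem_words => /eqP->.
by rewrite (_ : _ == k = false) ?mul0r ?mulr0 //; apply/eqP; lia.
Qed.

Lemma hom_comp_subspace i : is_subspace (hom_comp i).
Proof.
have /is_subspaceE[H0 HD] := lspan_subspace [set word K w | w in [set w | size w = i]].
apply/is_subspaceE; split=> [|c _ _ [a ai <-] [b bi <-]].
  by exists 0; rewrite ?raddf0.
by exists (c *: a + b); [exact: HD|rewrite linearP].
Qed.

Lemma homogM i j (a b : free_alg K) : homog i a -> homog j b -> homog (i + j) (a * b).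
Proof.
have /is_subspaceE[H0 HD] :=
  lspan_subspace [set word K w | w in [set w | size w = (i + j)%N]].
move=> + bj; move: a; apply: lspan_sub.
  apply/is_subspaceE; split=> [|c x y /= Hx Hy] /=; first by rewrite mul0r; exact: H0.
  by rewrite mulrDl -scalerAl; apply: HD.
move=> _ [u /= ui <-]; move: b bj; apply: lspan_sub.
  apply/is_subspaceE; split=> [|c x y /= Hx Hy] /=; first by rewrite mulr0; exact: H0.
  by rewrite mulrDr -scalerAr; apply: HD.
move=> _ [v /= vj <-]; rewrite /= -word_cat; apply: sub_lspan.
by exists (u ++ v) => //=; rewrite size_cat ui vj.
Qed.

Definition letters : set B := lspan (range (fun b => proj (letter K b))).

Lemma word1 b : word K [:: b] = letter K b.
Proof. by rewrite /word big_seq1. Qed.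

Lemma homog_word w : homog (size w) (word K w).
Proof. by apply: sub_lspan; exists w. Qed.

Lemma letters_hom : letters `<=` hom_comp 1.
Proof.
apply: lspan_sub => [|_ [b _ <-]]; first exact: hom_comp_subspace.
by exists (letter K b) => //; rewrite -word1; exact: (@homog_word [:: b]).
Qed.

Lemma powsp_hom i : powsp letters i `<=` hom_comp i.
Proof.
elim: i => [|i IH] /=.
  apply: lspan_sub => [|_ ->]; first exact: hom_comp_subspace.
  exists (word K [::]); first exact: (@homog_word [::]).
  by rewrite /word big_nil rmorph1.
apply: lspan_sub => [|_ [x /letters_hom[a ai <-] [y /IH[b bi <-] <-]]].
  exact: hom_comp_subspace.
by exists (a * b); [exact: (homogM ai bi)|rewrite rmorphM].
Qed.

Lemma letters_generate : generates letters.
Proof.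
rewrite /generates; apply/seteqP; split=> // x _ M [Malg LM].
have [M1 ML MM] : [/\ M 1, forall c x y, M x -> M y -> M (c *: x + y) &
    forall x y, M x -> M y -> M (x * y)].
  have [M1 ML MM] := Malg; split; first by rewrite -in_setE.
    by move=> c y z My Mz; rewrite -in_setE; apply: ML; rewrite in_setE.
  by move=> y z My Mz; rewrite -in_setE; apply: MM; rewrite in_setE.
have Mw w : M (proj (word K w)).
  elim: w => [|b w IH]; first by rewrite /word big_nil rmorph1.
  rewrite -cat1s word_cat rmorphM; apply: MM => //.
  by rewrite word1; apply: LM; apply: sub_lspan; exists b.
elim/syntactic_ind: x => a; move: a; apply: free_alg_ind => [|c w a Ma].
  by have := ML (-1) 1 1 M1 M1; rewrite scaleN1r addNr raddf0.
by rewrite linearP; apply: ML; [exact: Mw|exact: Ma].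
Qed.

Variable m : nat.
Hypothesis Phi_short : forall u v, exists u0 v0 c,
  [/\ (size u0 < m)%N, (size v0 < m)%N &
      forall w, Phi (u ++ w ++ v) = c * Phi (u0 ++ w ++ v0)].

Definition form_index n : seq (nat * (seq bool * seq bool)) :=
  [seq (k, p) | k <- iota 0 n.+1,
    p <- [seq (u, v) | u <- short_words m, v <- short_words m]].

Definition nth_form n (i : 'I_(size (form_index n))) : B -> K :=
  let: (k, (u, v)) := tnth (in_tuple (form_index n)) i in quot_form k u v.

Lemma nth_form_lin n i : is_lin (@nth_form n i).
Proof. by rewrite /nth_form; case: (tnth _ _) => k [u v]; apply: quot_form_lin. Qed.

(** Forms of degree above [n] vanish on [x], and by [Phi_short] every other one is a multiple of a
    form with short context. *)
Lemma nth_form_sep n x : bounded_part n x ->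
  (forall i, @nth_form n i x = 0) -> x = 0.
Proof.
move=> xn x0; apply: quot_form_inj => k u v.
have [nk|kn] := ltnP n k; first exact: xn.
have [u0 [v0 [c [su sv Phic]]]] := Phi_short u v.
have /tnthP[i iE] : (k, (u0, v0)) \in in_tuple (form_index n).
  by apply: allpairs_f; [rewrite mem_iota|apply: allpairs_f; rewrite mem_short_words].
have := x0 i; rewrite /nth_form -iE => eq0.
transitivity (c * quot_form k u0 v0 x); last by rewrite eq0 mulr0.
rewrite /quot_form /degree_form /pairing !mmapE mulr_sumr; apply: eq_bigr => w _.
by rewrite Phic; ring.
Qed.

Lemma bounded_part_dim n (U : set B) : U `<=` bounded_part n ->
  (lin_dim U <= n.+1 * (size (short_words m) * size (short_words m)))%N.
Proof.
have <- : size (form_index n) = (n.+1 * (size (short_words m) * size (short_words m)))%N.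
  by rewrite !size_allpairs size_iota.
apply: lin_dim_le; [exact: nth_form_lin|exact: bounded_part_subspace|].
exact: nth_form_sep.
Qed.

Lemma syntactic_quadratic_growth : at_most_quadratic_growth B.
Proof.
exists letters; split; first exact: lspan_subspace.
- have [|||q qd] := @has_dim_separated _ _ _ (@nth_form 1) letters.
  + exact: nth_form_lin.
  + exact: lspan_subspace.
  + by move=> x /letters_hom/(hom_comp_bounded (leqnn 1)); apply: nth_form_sep.
  by exists q.
- exact: letters_generate.
(* The growth is at most [n.+1 * s ^ 2], hence at most [2 * s ^ 2 * n], which is bounded by its own
   square. *)
set s := size (short_words m); exists (2 * (s * s))%N => n n1.
have : (growth letters n <= n.+1 * (s * s))%N.
  apply: bounded_part_dim; apply: lspan_sub; first exact: bounded_part_subspace.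
  move=> x [i /= i_n /powsp_hom]; apply: hom_comp_bounded.
  by rewrite -ltnS.
move/leq_trans; apply; move: (s * s)%N => c.
have : (2 * c * n <= (2 * c * n) ^ 2)%N by rewrite -mulnn; case: (2 * c * n)%N => // x;
  rewrite leq_pmulr.
by apply: leq_trans; nia.
Qed.

Hypothesis m_gt0 : (0 < m)%N.
Hypothesis Phi_long : forall i, exists2 w, size w = (i * m)%N & Phi w != 0.

(** If [n] vectors spanned, a nontrivial combination of [n.+1] forms of distinct degrees would
    vanish. Words of these degrees with nonzero [Phi] isolate its coefficients. *)
Lemma syntactic_infinite_dimensional : infinite_dimensional B.
Proof.
case=> n [b [_ bE]].
pose g (i : 'I_n.+1) := quot_form (i * m)%N [::] [::].
pose L := \matrix_(i < n.+1, l < n) g i (b l).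
have /rowV0Pn[c /sub_kermxP cL c0] : kermx L != 0.
  by rewrite -mxrank_eq0 mxrank_ker; have := rank_leq_col L; lia.
case/eqP: c0; apply/rowP => j; rewrite mxE.
pose f x := \sum_i c 0 i * g i x.
have lf : is_lin f.
  move=> e x y; rewrite /f mulr_sumr -big_split; apply: eq_bigr => i _ /=.
  by rewrite /g quot_form_lin; ring.
have f0 x : f x = 0.
  have : lspan (range b) x by rewrite -bE.
  rewrite lspan_range => -[a ->]; have [_ _ _ ->] := is_linE lf.
  rewrite big1 // => l _; suff -> : f (b l) = (c *m L) 0 l by rewrite cL mxE mulr0.
  by rewrite mxE; apply: eq_bigr => i _; rewrite mxE.
have [w sw Phiw] := Phi_long j.
have := f0 (proj (word K w)); rewrite /f (bigD1 j) //= big1 => [|i ij].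
  rewrite addr0 /g quot_form_proj /degree_form pairing_word sw eqxx mul1r cats0 /=.
  by move/eqP; rewrite mulf_eq0 (negbTE Phiw) orbF => /eqP.
rewrite /g quot_form_proj /degree_form pairing_word sw eqn_pmul2r //.
by rewrite (eq_sym (j : nat)) (inj_eq val_inj) (negbTE ij) mul0r mulr0.
Qed.

Lemma syntactic_surjection (X : set (free_alg K)) : X `<=` syntactic_ideal Phi ->
  exists f : {rmorphism alg_quot X -> B}, scalable f /\ forall b, exists a, f a = b.
Proof.
move=> XE; pose f (x : alg_quot X) : B := proj (repr x).
have fE a : f (quot_proj X a) = proj a.
  apply/syntactic_projP; have /quot_projP := quot_projK (quot_proj X a).
  by apply: smallest_sub => //; exact: syntactic_ideal_two_sided.
have ind (P : alg_quot X -> Prop) : (forall a, P (quot_proj X a)) -> forall x, P x.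
  by move=> Pp x; rewrite -[x]quot_projK.
have fB : zmod_morphism f.
  by elim/ind=> a; elim/ind=> b; rewrite -raddfB !fE raddfB.
have fM : monoid_morphism f.
  split; first by rewrite -(rmorph1 (quot_proj X)) fE rmorph1.
  by elim/ind=> a; elim/ind=> b; rewrite -rmorphM !fE rmorphM.
pose f' : {rmorphism alg_quot X -> B} := HB.pack f
  (GRing.isZmodMorphism.Build _ _ f fB) (GRing.isMonoidMorphism.Build _ _ f fM).
exists f'; split; first by move=> c; elim/ind=> a; rewrite -linearZ /= !fE linearZ.
by move=> x; exists (quot_proj X (syntactic_repr x)); rewrite /= fE syntactic_reprK.
Qed.

End SyntacticAlgebra.

(** * The periodic block product defining the quotient *)

Section PeriodicProduct.
Variables (K : fieldType) (m : nat) (e phi : bool -> seq bool -> K).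
Hypothesis m_gt0 : (0 < m)%N.
Hypothesis dual_phi : dual m e phi.

(** The value 0 at lengths not divisible by [m] gives multiplicativity as soon as one factor has
    length divisible by [m]. *)
Definition periodic_prod (w : seq bool) : K :=
  if (m %| size w)%N then block_prod m phi (nseq (size w %/ m) false) w else 0.

Lemma periodic_prodE i w : size w = (m * i)%N ->
  periodic_prod w = block_prod m phi (nseq i false) w.
Proof. by move=> sw; rewrite /periodic_prod sw dvdn_mulr // mulKn. Qed.

Lemma periodic_prod_nil : periodic_prod [::] != 0.
Proof. by rewrite (@periodic_prodE 0) ?muln0 //= oner_eq0. Qed.

(** Otherwise the pairing with the dual block product would be 0 instead of 1. *)
Lemma periodic_prod_long i : exists2 w, size w = (i * m)%N & periodic_prod w != 0.
Proof.
apply: contrapT => no_w.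
have := dual_block_prod dual_phi (erefl (size (nseq i false))).
rewrite size_nseq eqxx big_seq big1 => [/eqP|w]; first by rewrite eq_sym oner_eq0.
rewrite mem_words => /eqP sw; rewrite -(periodic_prodE sw).
have [->|w0] := eqVneq (periodic_prod w) 0; first by rewrite mulr0.
by case: no_w; exists w; rewrite // sw mulnC.
Qed.

Lemma periodic_prod_cat i u v : size u = (m * i)%N ->
  periodic_prod (u ++ v) = periodic_prod u * periodic_prod v.
Proof.
move=> su; rewrite (periodic_prodE su) {1}/periodic_prod size_cat su dvdn_addr ?dvdn_mulr //.
rewrite /periodic_prod; case: ifP => mv; last by rewrite mulr0.
rewrite mulnC divnMDl // nseqD block_prod_catE //.
by rewrite size_nseq.
Qed.

Lemma periodic_prod_catr i u v : size v = (m * i)%N ->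
  periodic_prod (u ++ v) = periodic_prod u * periodic_prod v.
Proof.
move=> sv; have [/dvdnP[j su]|mu] := boolP (m %| size u)%N.
  by apply: (@periodic_prod_cat j); rewrite su mulnC.
by rewrite /periodic_prod size_cat sv dvdn_addl ?dvdn_mulr // (negbTE mu) mul0r.
Qed.

(** Complete blocks at both ends split off and make up the scalar [c]. *)
Lemma periodic_prod_short u v : exists u0 v0 c,
  [/\ (size u0 < m)%N, (size v0 < m)%N &
     forall w, periodic_prod (u ++ w ++ v) = c * periodic_prod (u0 ++ w ++ v0)].
Proof.
set i := (size u %/ m)%N; set j := (size v %/ m)%N.
have [iu jv] : (m * i <= size u)%N /\ (m * j <= size v)%N.
  by rewrite ![(m * _)%N]mulnC !leq_trunc_div.
pose u1 := take (m * i) u; pose u0 := drop (m * i) u.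
pose v0 := take (size v - m * j) v; pose v1 := drop (size v - m * j) v.
have su1 : size u1 = (m * i)%N by rewrite size_takel.
have sv1 : size v1 = (m * j)%N by rewrite size_drop subKn.
exists u0, v0, (periodic_prod u1 * periodic_prod v1); split.
- have := divn_eq (size u) m; have := ltn_pmod (size u) m_gt0.
  by rewrite size_drop -/i; lia.
- have := divn_eq (size v) m; have := ltn_pmod (size v) m_gt0.
  by rewrite size_takel ?leq_subr // -/j; lia.
move=> w; rewrite -(cat_take_drop (m * i) u) -(cat_take_drop (size v - m * j) v).
rewrite -/u1 -/u0 -/v0 -/v1 -catA (periodic_prod_cat _ su1).
by rewrite !catA (periodic_prod_catr _ sv1); ring.
Qed.

(** Only the form of degree [k], in contexts of total length divisible by [m], can be nonzero; there
    [kills] applies with constant labels. *)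
Lemma kills_syntactic_ideal k (a : free_alg K) :
  homog k a -> kills m phi k (coef a) -> syntactic_ideal periodic_prod a.
Proof.
move=> ak ka j u v; rewrite /degree_form (pairing_homog _ ak).
have [jk|jk] := eqVneq k j; last first.
  rewrite big_seq big1 // => w; rewrite mem_words => /eqP->.
  by rewrite (negbTE jk) mul0r mulr0.
have [/dvdnP[i sz]|ndvd] := boolP (m %| size u + k + size v)%N; last first.
  rewrite big_seq big1 // => w; rewrite mem_words => /eqP sw.
  by rewrite /periodic_prod !size_cat sw addnA (negbTE ndvd) !mulr0.
have sz' : (size u + k + size v = m * size (nseq i false))%N by rewrite size_nseq sz mulnC.
rewrite -[RHS](ka _ _ _ sz'); apply: eq_words => w sw.
by rewrite sw jk eqxx mul1r (@periodic_prodE i) // !size_cat sw addnA sz mulnC.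
Qed.

End PeriodicProduct.

Theorem theorem2 (R : realType) (K : closedFieldType) (d : nat)
    (D : nat -> set (free_alg K))
    (hd : (50 <= d)%N)
    (hDsub : forall k, is_subspace (D k))
    (hDhom : forall k, D k `<=` homog k)
    (h1 : forall k : nat, (2 <= k)%N ->
      (k%:R / log2 k%:R : R) < (18 * d)%:R -> D k = [set 0])
    (h2 : forall k n : nat,
      2 ^ n%:Z - 2 ^ (n%:Z - 3) < (k%:R : R) <= 2 ^ n%:Z + 2 ^ (n%:Z - 1) ->
      D k = [set 0])
    (h3 : forall k j n : nat, D j <> [set 0] ->
      (j < 2 ^ n)%N -> (2 ^ n < k)%N -> (k < maxn (j ^ 1000) (12 * d * n * j))%N ->
      D k = [set 0])
    (h4 : forall k, (lin_dim (D k) <= k ^ d)%N)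
    (h5 : finite_set [set k | D k <> [set 0]]) :
  exists (B : algType K) (f : {rmorphism alg_quot (\bigcup_k D k) -> B}),
    [/\ scalable f, (forall b : B, exists a, f a = b),
        infinite_dimensional B & at_most_quadratic_growth B].
Proof.
have /finite_seqP[s sE] := h5.
(* Finiteness gives a largest degree [N] of relations, and the range up to [2 ^ N] contains them
   all. *)
have [e [ee [phi [dphi kphi _]]]] :=
  killing_functionals hd hDsub hDhom h1 h2 h3 h4 (\max_(k <- s) k).
have m0 : (0 < 2 ^ e)%N by rewrite expn_gt0.
have XE : \bigcup_k D k `<=` syntactic_ideal (periodic_prod (2 ^ e) phi).
  move=> a [k _ Dka]; apply: (kills_syntactic_ideal m0 (hDhom k a Dka)).
  have [Dk|Dk] := pselect (D k = [set 0]); first exact: (@kills_relations0 _ D _ phi k Dk a Dka).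
  apply: kphi Dka; have ks : k \in s by have : [set` s] k by rewrite -sE.
  by apply: leq_trans (ltnW (ltn_expl _ _)) => //; apply: leq_bigmax_seq.
have [f [fZ fsurj]] :=
  syntactic_surjection (periodic_prod_nil phi m0) XE.
exists (syntactic_alg (periodic_prod_nil phi m0)), f; split=> //.
- exact: syntactic_infinite_dimensional m0 (periodic_prod_long m0 dphi).
- exact: syntactic_quadratic_growth (periodic_prod_short phi m0).
Qed.
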